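(* Let $(\phi_t)$ be a non-elliptic semigroup in $\mathbb{D}$, with Denjoy-Wolff point $\tau\in \partial \mathbb{D}$ and $\phi_t'(\tau)=e^{-\lambda t}$ for $\lambda\geq 0$ and all $t\geq 0$ (in particular, $(\phi_t)$ is hyperbolic if $\lambda>0$, parabolic otherwise). Let $v(t), v^o(t), v^T(t)$ be its total, orthogonal and tangential speeds. Then $$\lim_{t\to +\infty}\frac{v(t)}{t}=\lim_{t\to+\infty} \frac{v^{o}(t)}{t}=\frac{\lambda}{2},$$ and $$\lim_{t\to +\infty}\frac{v^T(t)}{t}=0.$$
   Context: Let $\mathbb{D}=\{\zeta\in\mathbb{C}:|\zeta|<1\}$ with hyperbolic distance $\omega(z,w)=\frac12\log\frac{1+|T_z(w)|}{1-|T_z(w)|}$, $T_z(w)=\frac{z-w}{1-\overline{z}w}$. A non-elliptic semigroup in $\mathbb{D}$ is a family $(\phi_t)_{t\ge0}$ of holomorphic maps $\phi_t:\mathbb{D}\to\mathbb{D}$ such that $\phi_0=\mathrm{id}$, $\phi_{t+s}=\phi_t\circ\phi_s$ for all $s,t\ge0$, $t\mapsto\phi_t$ is continuous for the topology of uniform convergence on compacta of $\mathbb{D}$, and $\phi_t$ has no fixed point in $\mathbb{D}$ for $t>0$. Its Denjoy-Wolff point is the unique $\tau\in\partial\mathbb{D}$ such that $\lim_{t\to\infty}\phi_t(z)=\tau$ for all $z\in\mathbb{D}$. The angular derivative $\phi_t'(\tau)$ exists for all $t\ge0$ and there is a unique $\lambda\ge0$ (the spectral value) with $\phi_t'(\tau)=e^{-\lambda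 t}$ for all $t\ge 0$; the semigroup is hyperbolic if $\lambda>0$ and parabolic if $\lambda=0$. Let $\gamma:(-1,1)\to\mathbb{D}$, $\gamma(r)=r\tau$ (a geodesic), and for $z\in\mathbb{D}$ let $\pi_\gamma(z)$ be the unique point of $\gamma((-1,1))$ closest to $z$ with respect to $\omega$. The total speed is $v(t):=\omega(0,\phi_t(0))$, the orthogonal speed is $v^o(t):=\omega(0,\pi_\gamma(\phi_t(0)))$ and the tangential speed is $v^T(t):=\omega(\phi_t(0),\pi_\gamma(\phi_t(0)))$, $t\ge0$. *)

(* Defs.v *)
From Stdlib Require Import Reals List ClassicalEpsilon.
From Coquelicot Require Import Coquelicot.

Open Scope R_scope.

Definition in_disc (z : C) : Prop := Cmod z < 1.

Definition moebius (z w : C) : C := ((z - w) / (1 - Cconj z * w))%C.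

Definition hyp_dist (z w : C) : R :=
  / 2 * ln ((1 + Cmod (moebius z w)) / (1 - Cmod (moebius z w))).

Definition compact_set (K : C -> Prop) : Prop :=
  forall (I : Type) (U : I -> C -> Prop),
    (forall i, open (U i)) ->
    (forall z, K z -> exists i, U i z) ->
    exists l : list I, forall z, K z -> exists i, In i l /\ U i z.

Definition holomorphic_on_disc (f : C -> C) : Prop :=
  forall z : C, in_disc z -> ex_derive f z.

(* The maps [phi t] are total on [R] and [C]; only the values for [0 <= t] and
   for points of the disc are constrained or used. *)
Record nonelliptic_semigroup (phi : R -> C -> C) : Prop := {
  semigroup_disc : forall t z, 0 <= t -> in_disc z -> in_disc (phi t z);
  semigroup_holo : forall t, 0 <= t -> holomorphic_on_disc (phi t);
  semigroup_zero : forall z, in_disc z -> phi 0 z = z;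
  semigroup_add : forall s t z, 0 <= s -> 0 <= t -> in_disc z ->
    phi (t + s) z = phi t (phi s z);
  semigroup_cont : forall (t0 : R) (K : C -> Prop) (eps : R),
    0 <= t0 -> compact_set K -> (forall z, K z -> in_disc z) -> 0 < eps ->
    within (fun t => 0 <= t) (locally t0)
      (fun t => forall z, K z -> Cmod (phi t z - phi t0 z)%C < eps);
  semigroup_nonelliptic : forall t z, 0 < t -> in_disc z -> phi t z <> z
}.

Definition denjoy_wolff_point (phi : R -> C -> C) (tau : C) : Prop :=
  Cmod tau = 1 /\
  forall z : C, in_disc z ->
    filterlim (fun t => phi t z) (Rbar_locally p_infty) (locally tau).

Definition stolz_region (sigma : C) (M : R) (z : C) : Prop :=
  in_disc z /\ Cmod (sigma - z)%C < M * (1 - Cmod z).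

Definition angular_limit (f : C -> C) (sigma l : C) : Prop :=
  forall M : R, 1 < M ->
    filterlim f (within (stolz_region sigma M) (locally sigma)) (locally l).

(* [p] is the boundary value of [f] at [sigma] in the angular sense. *)
Definition angular_derivative (f : C -> C) (sigma a : C) : Prop :=
  exists p : C,
    angular_limit f sigma p /\
    angular_limit (fun z => ((f z - p) / (z - sigma))%C) sigma a.

Definition diameter (tau : C) (r : R) : C := (RtoC r * tau)%C.

Definition on_diameter (tau p : C) : Prop :=
  exists r : R, -1 < r < 1 /\ p = diameter tau r.

Definition closest_on_diameter (tau z p : C) : Prop :=
  on_diameter tau p /\
  forall q : C, on_diameter tau q -> hyp_dist z p <= hyp_dist z q.

(* For [Cmod tau = 1] and [z] in the disc the closest point exists and is
   unique, so that the choice made by [epsilon] is the orthogonal projection. *)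
Definition proj_diameter (tau z : C) : C :=
  epsilon (inhabits (RtoC 0)) (closest_on_diameter tau z).

Definition total_speed (phi : R -> C -> C) (t : R) : R :=
  hyp_dist (RtoC 0) (phi t (RtoC 0)).

Definition orthogonal_speed (phi : R -> C -> C) (tau : C) (t : R) : R :=
  hyp_dist (RtoC 0) (proj_diameter tau (phi t (RtoC 0))).

Definition tangential_speed (phi : R -> C -> C) (tau : C) (t : R) : R :=
  hyp_dist (phi t (RtoC 0)) (proj_diameter tau (phi t (RtoC 0))).

(* Main.v *)
Require Import Defs.
From Stdlib Require Import Reals Lra Lia Psatz ClassicalEpsilon.
From Coquelicot Require Import Coquelicot.

Open Scope R_scope.

(** Write [x t = phi t 0].  Up to bounded errors the three speeds are
    half-logarithms of elementary quantities: since
    [cosh^2 (hyp_dist z w) = |1 - conj z w|^2 / ((1 - |z|^2) (1 - |w|^2))], with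
    [L t = - ln (1 - |x t|^2)] and [b t = - ln |tau - x t|] one has
    [v = L / 2 + O(1)], [v^o = b / 2 + O(1)] and [v^T = (L - b) / 2 + O(1)]
    ([speeds_logarithms]).  For the last two, the orthogonal projection of [z] to
    the diameter is computed explicitly ([proj_diameter_foot]).  So it suffices
    that [L t / t] and [b t / t] tend to [lambda] ([orbit_asymptotics]).

    Everything about the orbit comes from one form of Julia's lemma ([julia]): if
    there are points [a] arbitrarily close to [tau], with [f a] also close to
    [tau] and [1 - |f a|^2 <= q (1 - |a|^2)], then [f] maps the horocycle
    [|tau - z|^2 / (1 - |z|^2) = k] into the horodisc of level [q k].  It is used
    three times.
    - With [a] on the orbit and [q = 1]: this is Wolff's lemma ([wolff]).  It makes
      [phi t (r tau)] tend to [tau] as [r] tends to 1, so that the angular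
      derivative is a derivative at a boundary fixed point.
    - With [a = r tau] and [q] slightly above [exp (- lambda t)]: this gives
      [|tau - x t|^2 <= exp (- lambda t) (1 - |x t|^2)], that is
      [lambda t + L t <= 2 b t] ([orbit_horocycle]).
    - With [a] on the orbit, [f = phi 1] and [q < exp (- lambda)], by
      contradiction: the conclusion would make the angular derivative of [phi 1]
      at most [q].  Hence [q (1 - |x s|^2) <= 1 - |x (s + 1)|^2] for large [s]
      ([orbit_step]), and [L t <= (lambda + eps) t + O(1)] ([gap_upper]).
    Together with the trivial bound [b t <= L t + ln 2] these squeeze both limits.

    Julia's lemma is a limit of the Schwarz-Pick inequality ([schwarz_pick]), which
    is proved for functions that are merely complex differentiable.  The flux form
    of Goursat's theorem ([goursat_flux]) in logarithmic polar coordinates shows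
    that the circular means of a holomorphic function are constant, hence that its
    value at 0 is at most its maximum on a circle ([Cmod_center_le_circle]).  If
    [A] maps the disc to itself and vanishes at [b], this is applied to
    [A^2 (A / T_b)^n], where [T_b] is the Moebius involution exchanging 0 and [b]:
    this function is differentiable at [b] by a direct estimate, so no removable
    singularity theorem is needed, and letting [n] tend to infinity yields
    [|A 0| <= |b|] ([schwarz_zero]). *)

(** * Goursat's theorem for a divergence-free field on a rectangle *)

(** The vector field [(P, Q)] is differentiable with zero divergence at each point of
    the rectangle [[a, b] x [c, d]].  Nothing is assumed about the continuity of
    the partial derivatives. *)
Definition divergence_free (P Q : R -> R -> R) (a b c d : R) : Prop :=
  forall x y, a <= x <= b -> c <= y <= d ->
  exists px py qx qy, differentiable_pt_lim P x y px py /\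
    differentiable_pt_lim Q x y qx qy /\ px + qy = 0.

(** Outward flux of [(P, Q)] through the boundary of [[a, b] x [c, d]]. *)
Definition flux (P Q : R -> R -> R) (a b c d : R) : R :=
  RInt (fun y => P b y) c d - RInt (fun y => P a y) c d +
  (RInt (fun x => Q x d) a b - RInt (fun x => Q x c) a b).

Lemma differentiable_continuous_y (P : R -> R -> R) x y px py :
  differentiable_pt_lim P x y px py -> continuous (fun t => P x t) y.
Proof.
  intros H. apply continuity_pt_filterlim, derivable_continuous_pt.
  exists (px * 0 + py * 1).
  apply (derivable_pt_lim_comp_2d P (fun _ => x) (fun t => t)); auto.
  - apply derivable_pt_lim_const.
  - apply derivable_pt_lim_id.
Qed.

Lemma differentiable_continuous_x (P : R -> R -> R) x y px py :
  differentiable_pt_lim P x y px py -> continuous (fun t => P t y) x.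
Proof.
  intros H. apply continuity_pt_filterlim, derivable_continuous_pt.
  exists (px * 1 + py * 0).
  apply (derivable_pt_lim_comp_2d P (fun t => t) (fun _ => y)); auto.
  - apply derivable_pt_lim_id.
  - apply derivable_pt_lim_const.
Qed.

Lemma ex_RInt_vertical P Q a b c d x y1 y2 : divergence_free P Q a b c d ->
  a <= x <= b -> c <= y1 <= d -> c <= y2 <= d -> ex_RInt (fun y => P x y) y1 y2.
Proof.
  intros H Hx Hy1 Hy2. apply (ex_RInt_continuous (V := R_CompleteNormedModule)).
  intros z Hz.
  assert (c <= z <= d) by (revert Hz; unfold Rmin, Rmax; destruct Rle_dec; lra).
  destruct (H x z) as (px & py & qx & qy & HP & _); auto.
  exact (differentiable_continuous_y _ _ _ _ _ HP).
Qed.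

Lemma ex_RInt_horizontal P Q a b c d y x1 x2 : divergence_free P Q a b c d ->
  c <= y <= d -> a <= x1 <= b -> a <= x2 <= b -> ex_RInt (fun x => Q x y) x1 x2.
Proof.
  intros H Hx Hy1 Hy2. apply (ex_RInt_continuous (V := R_CompleteNormedModule)).
  intros z Hz.
  assert (a <= z <= b) by (revert Hz; unfold Rmin, Rmax; destruct Rle_dec; lra).
  destruct (H z y) as (px & py & qx & qy & _ & HQ & _); auto.
  exact (differentiable_continuous_x _ _ _ _ _ HQ).
Qed.

Lemma flux_quarters P Q a b c d m n : divergence_free P Q a b c d ->
  a <= m <= b -> c <= n <= d ->
  flux P Q a b c d = flux P Q a m c n + flux P Q m b c n +
                     flux P Q a m n d + flux P Q m b n d.
Proof.
  intros H Hm Hn. unfold flux.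
  assert (EP : forall x, a <= x <= b ->
    RInt (fun y => P x y) c n + RInt (fun y => P x y) n d = RInt (fun y => P x y) c d).
  { intros x Hx.
    apply (RInt_Chasles (V := R_CompleteNormedModule) (fun y => P x y));
      apply (ex_RInt_vertical P Q a b c d); auto; lra. }
  assert (EQ : forall y, c <= y <= d ->
    RInt (fun x => Q x y) a m + RInt (fun x => Q x y) m b = RInt (fun x => Q x y) a b).
  { intros y Hy.
    apply (RInt_Chasles (V := R_CompleteNormedModule) (fun x => Q x y));
      apply (ex_RInt_horizontal P Q a b c d); auto; lra. }
  rewrite <- (EP a), <- (EP b), <- (EQ c), <- (EQ d) by lra. lra.
Qed.

Lemma RInt_near_const (f g : R -> R) a b k M : a <= b ->
  ex_RInt f a b -> ex_RInt g a b ->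
  (forall t, a <= t <= b -> Rabs (f t - g t - k) <= M) ->
  Rabs (RInt f a b - RInt g a b - k * (b - a)) <= (b - a) * M.
Proof.
  intros Hab Hf Hg H.
  assert (E : RInt (fun t => f t - g t - k) a b = RInt f a b - RInt g a b - k * (b - a)).
  { rewrite (RInt_minus (V := R_CompleteNormedModule) (fun t => f t - g t) (fun _ => k)).
    - rewrite (RInt_minus (V := R_CompleteNormedModule) f g) by auto.
      rewrite RInt_const. unfold minus, plus, opp, scal; simpl. unfold mult; simpl. ring.
    - apply (ex_RInt_minus (V := R_CompleteNormedModule)); auto.
    - apply ex_RInt_const. }
  rewrite <- E. apply abs_RInt_le_const; auto.
  apply (ex_RInt_minus (V := R_CompleteNormedModule) (fun t => f t - g t)).
  - apply (ex_RInt_minus (V := R_CompleteNormedModule)); auto.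
  - apply ex_RInt_const.
Qed.

(** The flux of the affine part of the field at [(x0, y0)] is
    [(px + qy) * w * h = 0], so only the differentiability remainder contributes. *)
Lemma flux_small_rectangle P Q a b c d x0 y0 eps : divergence_free P Q a b c d ->
  a <= x0 <= b -> c <= y0 <= d -> 0 < eps ->
  exists delta, 0 < delta /\ forall x y w h m,
    a <= x -> x + w <= b -> c <= y -> y + h <= d ->
    x <= x0 <= x + w -> y <= y0 <= y + h -> w <= m -> h <= m -> m < delta ->
    Rabs (flux P Q x (x + w) y (y + h)) <= 4 * eps * m ^ 2.
Proof.
  intros HD Hx0 Hy0 He.
  destruct (HD x0 y0 Hx0 Hy0) as (px & py & qx & qy & HP & HQ & E).
  destruct (HP (mkposreal eps He)) as [d1 H1].
  destruct (HQ (mkposreal eps He)) as [d2 H2]. simpl in H1, H2.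
  exists (Rmin d1 d2). split. { apply Rmin_pos; apply cond_pos. }
  intros x y w h m Hxa Hxb Hyc Hyd Hx Hy Hw Hh Hm.
  assert (m < d1) by (eapply Rlt_le_trans; [exact Hm | apply Rmin_l]).
  assert (m < d2) by (eapply Rlt_le_trans; [exact Hm | apply Rmin_r]).
  assert (near : forall u u0 z, z <= u <= z + m -> z <= u0 <= z + m -> Rabs (u - u0) <= m).
  { intros. apply Rabs_le; lra. }
  assert (BP : forall u v, x <= u <= x + w -> y <= v <= y + h ->
     Rabs (P u v - P x0 y0 - (px * (u - x0) + py * (v - y0))) <= eps * m).
  { intros u v Hu Hv.
    assert (Rabs (u - x0) <= m) by (apply (near _ _ x); lra).
    assert (Rabs (v - y0) <= m) by (apply (near _ _ y); lra).
    eapply Rle_trans. { apply H1; lra. }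
    apply Rmult_le_compat_l; [lra|]. apply Rmax_lub; auto. }
  assert (BQ : forall u v, x <= u <= x + w -> y <= v <= y + h ->
     Rabs (Q u v - Q x0 y0 - (qx * (u - x0) + qy * (v - y0))) <= eps * m).
  { intros u v Hu Hv.
    assert (Rabs (u - x0) <= m) by (apply (near _ _ x); lra).
    assert (Rabs (v - y0) <= m) by (apply (near _ _ y); lra).
    eapply Rle_trans. { apply H2; lra. }
    apply Rmult_le_compat_l; [lra|]. apply Rmax_lub; auto. }
  assert (KP := RInt_near_const (fun t => P (x + w) t) (fun t => P x t) y (y + h)
                 (px * w) (2 * (eps * m))).
  assert (KQ := RInt_near_const (fun t => Q t (y + h)) (fun t => Q t y) x (x + w)
                 (qy * h) (2 * (eps * m))).
  assert (KP' : Rabs (RInt (fun t => P (x + w) t) y (y + h) -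
      RInt (fun t => P x t) y (y + h) - px * w * (y + h - y)) <= (y + h - y) * (2 * (eps * m))).
  { apply KP; [lra| | |]; try (apply (ex_RInt_vertical P Q a b c d); auto; lra).
    intros t Ht.
    assert (A1 := BP (x + w) t ltac:(lra) Ht). assert (A2 := BP x t ltac:(lra) Ht).
    apply Rabs_le_between in A1. apply Rabs_le_between in A2. apply Rabs_le; lra. }
  assert (KQ' : Rabs (RInt (fun t => Q t (y + h)) x (x + w) -
      RInt (fun t => Q t y) x (x + w) - qy * h * (x + w - x)) <= (x + w - x) * (2 * (eps * m))).
  { apply KQ; [lra| | |]; try (apply (ex_RInt_horizontal P Q a b c d); auto; lra).
    intros t Ht.
    assert (A1 := BQ t (y + h) Ht ltac:(lra)). assert (A2 := BQ t y Ht ltac:(lra)).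
    apply Rabs_le_between in A1. apply Rabs_le_between in A2. apply Rabs_le; lra. }
  clear KP KQ. unfold flux.
  assert (0 <= m) by lra.
  assert (0 <= eps * m) by (apply Rmult_le_pos; lra).
  assert (h * (eps * m) <= m * (eps * m)) by (apply Rmult_le_compat_r; lra).
  assert (w * (eps * m) <= m * (eps * m)) by (apply Rmult_le_compat_r; lra).
  replace qy with (- px) in KQ' by lra.
  apply Rabs_le_between in KP'. apply Rabs_le_between in KQ'.
  apply Rabs_le; split; nra.
Qed.

(** Bisection step: [p] is the lower left corner of a rectangle of size
    [w / 2^n] by [h / 2^n], and the result is the corner of a quarter of it on which
    the flux exceeds [eta / 4^(n + 1)], if there is one. *)
Definition next_corner (P Q : R -> R -> R) (w h eta : R) (n : nat) (p : R * R) : R * R :=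
  let w' := w / 2 ^ S n in let h' := h / 2 ^ S n in
  let large x y := Rlt_dec (eta / 4 ^ S n) (Rabs (flux P Q x (x + w') y (y + h'))) in
  let (x, y) := p in
  if large x y then (x, y) else if large (x + w') y then (x + w', y)
  else if large x (y + h') then (x, y + h') else (x + w', y + h').

Fixpoint corner (P Q : R -> R -> R) (w h eta : R) (p : R * R) (n : nat) : R * R :=
  match n with O => p | S n => next_corner P Q w h eta n (corner P Q w h eta p n) end.

(** The flux is additive over the four quarters, so one of them carries at least a
    quarter of it: the flux stays above [eta / 4^n] along the nested rectangles. *)
Lemma corner_spec P Q a c w h eta : 0 < w -> 0 < h ->
  divergence_free P Q a (a + w) c (c + h) ->
  eta < Rabs (flux P Q a (a + w) c (c + h)) ->
  forall n, let (x, y) := corner P Q w h eta (a, c) n in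
  let (x', y') := corner P Q w h eta (a, c) (S n) in
  eta / 4 ^ n < Rabs (flux P Q x (x + w / 2 ^ n) y (y + h / 2 ^ n)) /\
  a <= x <= x' /\ c <= y <= y' /\
  x' + w / 2 ^ S n <= x + w / 2 ^ n <= a + w /\
  y' + h / 2 ^ S n <= y + h / 2 ^ n <= c + h.
Proof.
  intros Hw Hh HD Hlarge.
  assert (Hhalf : forall u n, u / 2 ^ n = 2 * (u / 2 ^ S n)).
  { intros u n. simpl. field. apply pow_nonzero; lra. }
  assert (Hpos : forall u n, 0 < u -> 0 < u / 2 ^ n).
  { intros u n Hu. apply Rdiv_lt_0_compat; auto. apply pow_lt; lra. }
  assert (geom : forall n x y, corner P Q w h eta (a, c) n = (x, y) ->
    let (x', y') := corner P Q w h eta (a, c) (S n) in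
    x <= x' /\ y <= y' /\ x' + w / 2 ^ S n <= x + w / 2 ^ n /\
    y' + h / 2 ^ S n <= y + h / 2 ^ n).
  { intros n x y E. cbn [corner]. rewrite E. unfold next_corner.
    rewrite (Hhalf w n), (Hhalf h n).
    assert (A := Hpos w (S n) Hw). assert (B := Hpos h (S n) Hh).
    repeat (destruct Rlt_dec); lra. }
  assert (bnd : forall n, let (x, y) := corner P Q w h eta (a, c) n in
    a <= x /\ c <= y /\ x + w / 2 ^ n <= a + w /\ y + h / 2 ^ n <= c + h /\
    eta / 4 ^ n < Rabs (flux P Q x (x + w / 2 ^ n) y (y + h / 2 ^ n))).
  { induction n.
    - simpl. replace (w / 1) with w by field. replace (h / 1) with h by field.
      replace (eta / 1) with eta by field. repeat split; auto; lra.
    - assert (G := geom n). cbn [corner] in *.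
      destruct (corner P Q w h eta (a, c) n) as [x y].
      specialize (G x y eq_refl). destruct IHn as (I1 & I2 & I3 & I4 & I5).
      destruct (next_corner P Q w h eta n (x, y)) as [x' y'] eqn:E.
      repeat split; try lra.
      assert (A := Hpos w (S n) Hw). assert (B := Hpos h (S n) Hh).
      rewrite (Hhalf w n), (Hhalf h n) in *.
      revert E. unfold next_corner.
      assert (Hsum : eta / 4 ^ n = 4 * (eta / 4 ^ S n)).
      { simpl. field. apply pow_nonzero; lra. }
      rewrite Hsum in I5.
      remember (w / 2 ^ S n) as w'. remember (h / 2 ^ S n) as h'.
      remember (eta / 4 ^ S n) as e.
      repeat destruct Rlt_dec; intros E; inversion E; subst x' y'; auto.
      rewrite (flux_quarters P Q x _ y _ (x + w') (y + h')) in I5; [| |lra|lra].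
      + replace (x + 2 * w') with (x + w' + w') in I5 by ring.
        replace (y + 2 * h') with (y + h' + h') in I5 by ring.
        revert I5 n0 n1 n2. clear. intros.
        set (f1 := flux P Q x (x + w') y (y + h')) in *.
        set (f2 := flux P Q (x + w') (x + w' + w') y (y + h')) in *.
        set (f3 := flux P Q x (x + w') (y + h') (y + h' + h')) in *.
        set (f4 := flux P Q (x + w') (x + w' + w') (y + h') (y + h' + h')) in *.
        assert (T1 := Rabs_triang (f1 + f2 + f3) f4).
        assert (T2 := Rabs_triang (f1 + f2) f3).
        assert (T3 := Rabs_triang f1 f2). lra.
      + intros u v Hu Hv. apply HD; lra. }
  intros n. assert (B := bnd n). assert (B' := bnd (S n)). assert (G := geom n).
  destruct (corner P Q w h eta (a, c) n) as [x y].
  specialize (G x y eq_refl).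
  destruct (corner P Q w h eta (a, c) (S n)) as [x' y'].
  repeat split; lra.
Qed.

Lemma nested_intervals (x e : nat -> R) :
  (forall n, x n <= x (S n) /\ x (S n) + e (S n) <= x n + e n /\ 0 <= e n) ->
  exists l, forall n, x n <= l <= x n + e n.
Proof.
  intros H.
  assert (up : forall n k, x n <= x (n + k)%nat /\ x (n + k)%nat + e (n + k)%nat <= x n + e n).
  { intros n k. induction k.
    - rewrite Nat.add_0_r. lra.
    - rewrite Nat.add_succ_r. specialize (H (n + k)%nat). lra. }
  assert (le : forall n k, x n <= x k + e k).
  { intros n k. destruct (Nat.le_ge_cases n k) as [h | h].
    - replace k with (n + (k - n))%nat by lia. specialize (up n (k - n)%nat).
      specialize (H (n + (k - n))%nat). lra.
    - replace n with (k + (n - k))%nat by lia. specialize (up k (n - k)%nat).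
      specialize (H (k + (n - k))%nat). lra. }
  destruct (completeness (fun r => exists n, r = x n)) as [l [Hub Hlub]].
  - exists (x O + e O). intros r [n ->]. apply le.
  - exists (x O), O; auto.
  - exists l. intros n. split.
    + apply Hub. exists n; auto.
    + apply Hlub. intros r [k ->]. apply le.
Qed.

(** The nested rectangles of the bisection shrink to a point, where the flux bound of
    [flux_small_rectangle] is of smaller order than their area. *)
Lemma goursat_flux P Q a b c d : a < b -> c < d ->
  divergence_free P Q a b c d -> flux P Q a b c d = 0.
Proof.
  intros Hab Hcd HD.
  destruct (Req_dec (flux P Q a b c d) 0) as [|Hne]; auto. exfalso.
  set (w := b - a). set (h := d - c).
  assert (Hw : 0 < w) by (unfold w; lra). assert (Hh : 0 < h) by (unfold h; lra).
  replace b with (a + w) in * by (unfold w; ring).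
  replace d with (c + h) in * by (unfold h; ring).
  clearbody w h.
  set (eta := Rabs (flux P Q a (a + w) c (c + h)) / 2).
  assert (He : 0 < eta).
  { apply Rabs_pos_lt in Hne. unfold eta; lra. }
  assert (Hl : eta < Rabs (flux P Q a (a + w) c (c + h))) by (unfold eta in *; lra).
  clearbody eta.
  assert (Hpos : forall u n, 0 < u -> 0 < u / 2 ^ n).
  { intros u n Hu. apply Rdiv_lt_0_compat; auto. apply pow_lt; lra. }
  assert (HS := corner_spec P Q a c w h eta Hw Hh HD Hl).
  set (p := corner P Q w h eta (a, c)) in *.
  assert (S' : forall n, eta / 4 ^ n < Rabs (flux P Q (fst (p n)) (fst (p n) + w / 2 ^ n)
      (snd (p n)) (snd (p n) + h / 2 ^ n)) /\
    a <= fst (p n) <= fst (p (S n)) /\ c <= snd (p n) <= snd (p (S n)) /\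
    fst (p (S n)) + w / 2 ^ S n <= fst (p n) + w / 2 ^ n <= a + w /\
    snd (p (S n)) + h / 2 ^ S n <= snd (p n) + h / 2 ^ n <= c + h).
  { intros n. specialize (HS n). destruct (p n), (p (S n)). exact HS. }
  clear HS.
  destruct (nested_intervals (fun n => fst (p n)) (fun n => w / 2 ^ n)) as [x0 Hx0].
  { intros n. destruct (S' n) as (_ & h1 & h2 & h3 & h4). assert (A := Hpos w n Hw).
    repeat split; lra. }
  destruct (nested_intervals (fun n => snd (p n)) (fun n => h / 2 ^ n)) as [y0 Hy0].
  { intros n. destruct (S' n) as (_ & h1 & h2 & h3 & h4). assert (A := Hpos h n Hh).
    repeat split; lra. }
  set (m := Rmax w h).
  assert (Hm : 0 < m) by (apply Rlt_le_trans with w; [auto | apply Rmax_l]).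
  destruct (flux_small_rectangle P Q a (a + w) c (c + h) x0 y0 (eta / (4 * m ^ 2)) HD)
    as (delta & Hd & Hsmall).
  { specialize (S' O). specialize (Hx0 O). simpl in *. lra. }
  { specialize (S' O). specialize (Hy0 O). simpl in *. lra. }
  { apply Rdiv_lt_0_compat; auto. assert (0 < m ^ 2) by (apply pow_lt; auto). lra. }
  destruct (pow_lt_1_zero (/ 2)) with (y := delta / m) as [N HN].
  { rewrite Rabs_pos_eq; lra. }
  { apply Rdiv_lt_0_compat; auto. }
  specialize (HN N (Nat.le_refl _)).
  rewrite Rabs_pos_eq in HN by (apply pow_le; lra).
  rewrite pow_inv in HN.
  assert (Hp2 : 0 < / 2 ^ N) by (apply Rinv_0_lt_compat, pow_lt; lra).
  destruct (S' N) as (h0 & h1 & h2 & h3 & h4).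
  assert (C : Rabs (flux P Q (fst (p N)) (fst (p N) + w / 2 ^ N)
      (snd (p N)) (snd (p N) + h / 2 ^ N)) <= 4 * (eta / (4 * m ^ 2)) * (m / 2 ^ N) ^ 2).
  { apply Hsmall; try lra.
    - apply Hx0.
    - apply Hy0.
    - apply Rmult_le_compat_r; [lra | apply Rmax_l].
    - apply Rmult_le_compat_r; [lra | apply Rmax_r].
    - unfold Rdiv. apply Rmult_lt_compat_l with (r := m) in HN; auto.
      replace (m * (delta / m)) with delta in HN by (field; lra). exact HN. }
  assert (E : 4 * (eta / (4 * m ^ 2)) * (m / 2 ^ N) ^ 2 = eta / 4 ^ N).
  { replace (4 ^ N) with (2 ^ N * 2 ^ N)
      by (rewrite <- Rpow_mult_distr; replace (2 * 2) with 4 by ring; reflexivity).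
    field. split; [apply pow_nonzero; lra | lra]. }
  lra.
Qed.

(** * Complex derivatives and circular means *)

(** Complex differentiability with derivative [l], stated with the modulus only.  The
    library notion occurs for two normed-module structures on [C], whose norms are
    equal but which are not the same structure: [holomorphic_on_disc] uses
    [C_NormedModule], while the product and chain rules below are available for the
    ring [C_AbsRing] as a module over itself. *)
Definition Cderiv (f : C -> C) (z l : C) : Prop :=
  forall eps, 0 < eps -> exists delta, 0 < delta /\ forall w, Cmod (w - z) < delta ->
    Cmod (f w - f z - l * (w - z)) <= eps * Cmod (w - z).

Notation is_Cderive := (@is_derive C_AbsRing (AbsRing_NormedModule C_AbsRing)).

Lemma ex_derive_Cderiv (f : C -> C) z :
  @ex_derive C_AbsRing C_NormedModule f z -> exists l, Cderiv f z l.
Proof.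
  intros [l [_ Hl]]. exists l. intros eps He.
  destruct (Hl z (fun P HP => HP) (mkposreal eps He)) as [d Hd].
  exists d. split; [apply cond_pos|]. intros w Hw.
  specialize (Hd w Hw). simpl in Hd.
  rewrite (Cmult_comm l). exact Hd.
Qed.

Lemma is_derive_Cderiv (f : C -> C) z l : is_Cderive f z l <-> Cderiv f z l.
Proof.
  split.
  - intros [_ Hl] eps He.
    destruct (Hl z (fun P HP => HP) (mkposreal eps He)) as [d Hd].
    exists d. split; [apply cond_pos|]. intros w Hw.
    specialize (Hd w Hw). simpl in Hd. rewrite (Cmult_comm l). exact Hd.
  - intros H. split.
    + apply is_linear_scal_l.
    + intros x Hx eps.
      apply (is_filter_lim_locally_unique (K := C_AbsRing)
        (V := AbsRing_NormedModule C_AbsRing)) in Hx.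
      subst x.
      destruct (H eps (cond_pos eps)) as (d & Hd & B).
      exists (mkposreal d Hd). intros w Hw.
      specialize (B w Hw). rewrite (Cmult_comm l) in B. exact B.
Qed.

Lemma Cderiv_continuous f z l : Cderiv f z l ->
  forall eps, 0 < eps -> exists delta, 0 < delta /\
  forall w, Cmod (w - z) < delta -> Cmod (f w - f z) < eps.
Proof.
  intros H eps He. destruct (H 1 Rlt_0_1) as (d & Hd & B).
  set (K := 1 + Cmod l). assert (HK : 1 <= K) by (unfold K; generalize (Cmod_ge_0 l); lra).
  exists (Rmin d (eps / K)). split.
  { apply Rmin_pos; auto. apply Rdiv_lt_0_compat; lra. }
  intros w Hw.
  assert (Hw1 := Rlt_le_trans _ _ _ Hw (Rmin_l _ _)).
  assert (Hw2 := Rlt_le_trans _ _ _ Hw (Rmin_r _ _)).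
  specialize (B w Hw1).
  replace (f w - f z)%C with ((f w - f z - l * (w - z)) + l * (w - z))%C by ring.
  eapply Rle_lt_trans. { apply Cmod_triangle. }
  rewrite Cmod_mult.
  apply Rle_lt_trans with (K * Cmod (w - z)). { unfold K; lra. }
  apply Rmult_lt_compat_l with (r := K) in Hw2; [|lra].
  replace (K * (eps / K)) with eps in Hw2 by (field; lra). exact Hw2.
Qed.

(** The second partial derivative contains the factor [Ci] because [f] has
    derivative [i l] in the direction of the imaginary axis. *)
Lemma differentiable_pt_lim_Re_mult (c : C) (f : C -> C) (u v : R) (l : C) : Cderiv f (u, v) l ->
  differentiable_pt_lim (fun u v => Re (c * f (u, v))%C) u v
    (Re (c * l)%C) (Re (Ci * c * l)%C).
Proof.
  intros H eps.
  set (K := 2 * (1 + Cmod c)).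
  assert (HK : 2 <= K) by (unfold K; generalize (Cmod_ge_0 c); lra).
  destruct (H (eps / K)) as (d & Hd & B).
  { apply Rdiv_lt_0_compat; [apply cond_pos | lra]. }
  assert (Hd2 : 0 < d / 2) by lra.
  exists (mkposreal _ Hd2). intros u' v' Hu Hv. simpl in Hu, Hv.
  assert (HM : Cmod ((u', v') - (u, v))%C <= 2 * Rmax (Rabs (u' - u)) (Rabs (v' - v))).
  { eapply Rle_trans. { apply Cmod_2Rmax. }
    apply Rmult_le_compat_r.
    - eapply Rle_trans; [apply Rabs_pos | apply Rmax_l].
    - rewrite <- (sqrt_square 2) at 2 by lra. apply sqrt_le_1_alt. lra. }
  assert (Hlt : Cmod ((u', v') - (u, v))%C < d).
  { eapply Rle_lt_trans; [exact HM|]. apply Rmax_case; lra. }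
  specialize (B _ Hlt).
  replace (Re (c * f (u', v')) - Re (c * f (u, v)) -
    (Re (c * l) * (u' - u) + Re (Ci * c * l) * (v' - v)))
    with (Re (c * (f (u', v') - f (u, v) - l * ((u', v') - (u, v))))%C)
    by (destruct c, l, (f (u', v')), (f (u, v)); simpl; ring).
  eapply Rle_trans. { apply re_le_Cmod. }
  rewrite Cmod_mult.
  set (m := Rmax (Rabs (u' - u)) (Rabs (v' - v))) in *.
  assert (B' : Cmod (f (u', v') - f (u, v) - l * ((u', v') - (u, v)))%C <= eps / K * (2 * m)).
  { eapply Rle_trans; [exact B|]. apply Rmult_le_compat_l; auto.
    apply Rlt_le, Rdiv_lt_0_compat; [apply cond_pos | lra]. }
  apply Rmult_le_compat_l with (r := Cmod c) in B'; [|apply Cmod_ge_0].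
  eapply Rle_trans; [exact B'|].
  assert (0 <= eps / K * (2 * m)).
  { apply Rmult_le_pos. apply Rlt_le, Rdiv_lt_0_compat; [apply cond_pos | lra].
    assert (0 <= m); [|lra]. eapply Rle_trans; [apply Rabs_pos | apply Rmax_l]. }
  replace (eps * m) with ((1 + Cmod c) * (eps / K * (2 * m))).
  - lra.
  - unfold K. field. generalize (Cmod_ge_0 c); lra.
Qed.

Lemma differentiable_pt_lim_Rmult x y : differentiable_pt_lim Rmult x y y x.
Proof.
  intros eps. exists eps. intros u v Hu Hv.
  replace (u * v - x * y - (y * (u - x) + x * (v - y))) with ((u - x) * (v - y)) by ring.
  rewrite Rabs_mult. apply Rmult_le_compat; try apply Rabs_pos; [lra | apply Rmax_r].
Qed.

Lemma differentiable_pt_lim_snd (g : R -> R) x y l : derivable_pt_lim g y l ->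
  differentiable_pt_lim (fun _ v => g v) x y 0 l.
Proof.
  intros H eps. destruct (H eps (cond_pos eps)) as [d Hd].
  exists d. intros u v _ Hv.
  apply Rle_trans with (eps * Rabs (v - y)).
  2: { apply Rmult_le_compat_l; [apply Rlt_le, cond_pos | apply Rmax_r]. }
  destruct (Req_dec v y) as [-> | Hne].
  - replace (g y - g y - (0 * (u - x) + l * (y - y))) with 0 by ring.
    rewrite Rminus_diag, Rabs_R0. lra.
  - specialize (Hd (v - y) ltac:(lra) Hv). replace (y + (v - y)) with v in Hd by ring.
    replace (g v - g y - (0 * (u - x) + l * (v - y)))
      with (((g v - g y) / (v - y) - l) * (v - y)) by (field; lra).
    rewrite Rabs_mult. apply Rmult_le_compat_r; [apply Rabs_pos | lra].
Qed.

Lemma differentiable_pt_lim_prod (f g : R -> R) x y l m :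
  derivable_pt_lim f x l -> derivable_pt_lim g y m ->
  differentiable_pt_lim (fun x y => f x * g y) x y (l * g y) (f x * m).
Proof.
  intros Hf Hg.
  replace (l * g y) with (g y * l + f x * 0) by ring.
  replace (f x * m) with (g y * 0 + f x * m) by ring.
  apply (differentiable_pt_lim_comp Rmult (fun x _ => f x) (fun _ y => g y)).
  - apply differentiable_pt_lim_Rmult.
  - apply differentiable_pt_lim_proj1_0; auto.
  - apply differentiable_pt_lim_snd; auto.
Qed.

(** The complex exponential [exp (x + i y)], as a point in polar coordinates. *)
Definition Cpolar (x y : R) : C := (exp x * cos y, exp x * sin y).

Lemma Cmod_Cpolar x y : Cmod (Cpolar x y) = exp x.
Proof.
  unfold Cmod, Cpolar; simpl fst; simpl snd.
  replace ((exp x * cos y) ^ 2 + (exp x * sin y) ^ 2) with (exp x * exp x).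
  - apply sqrt_square, Rlt_le, exp_pos.
  - assert (E := sin2_cos2 y). unfold Rsqr in E. nra.
Qed.

(** The field [(Re (c F), Re (i c F))] with [F (x + i y) = H (exp (x + i y))] is
    divergence free by the Cauchy-Riemann equations. *)
Lemma polar_divergence_free (H : C -> C) (c : C) a b t t' : b < 0 ->
  (forall z, in_disc z -> exists l, Cderiv H z l) ->
  divergence_free (fun x y => Re (c * H (Cpolar x y))%C)
                  (fun x y => Re (Ci * c * H (Cpolar x y))%C) a b t t'.
Proof.
  intros Hb HH x y Hx _.
  destruct (HH (Cpolar x y)) as [l Hl].
  { unfold in_disc. rewrite Cmod_Cpolar, <- exp_0. apply exp_increasing; lra. }
  assert (D1 := differentiable_pt_lim_prod exp cos x y _ _
    (derivable_pt_lim_exp x) (derivable_pt_lim_cos y)).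
  assert (D2 := differentiable_pt_lim_prod exp sin x y _ _
    (derivable_pt_lim_exp x) (derivable_pt_lim_sin y)).
  do 4 eexists. split; [|split].
  - apply (differentiable_pt_lim_comp (fun u v => Re (c * H (u, v))%C)
      (fun x y => exp x * cos y) (fun x y => exp x * sin y)).
    + apply differentiable_pt_lim_Re_mult, Hl.
    + apply D1.
    + apply D2.
  - apply (differentiable_pt_lim_comp (fun u v => Re (Ci * c * H (u, v))%C)
      (fun x y => exp x * cos y) (fun x y => exp x * sin y)).
    + apply differentiable_pt_lim_Re_mult, Hl.
    + apply D1.
    + apply D2.
  - destruct c, l. simpl. ring.
Qed.

(** By periodicity the horizontal sides of a rectangle of height [2 PI] cancel in the
    flux, so the mean of [Re (c H)] over the circle of radius [exp x] does not
    depend on [x].  It tends to [Re (c H(0))] as [x] tends to minus infinity. *)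
Lemma Cmod_center_le_circle (H : C -> C) r M :
  (forall z, in_disc z -> exists l, Cderiv H z l) -> 0 < r < 1 ->
  (forall z, Cmod z = r -> Cmod (H z) <= M) -> Cmod (H 0) <= M.
Proof.
  intros HH Hr HM. destruct (Rle_lt_dec (Cmod (H 0)) M) as [|Hlt]; auto. exfalso.
  (* With this [c], [Re (c * H 0)] is [|H 0|^2]. *)
  set (c := Cconj (H 0)). set (m := Cmod (H 0)) in *.
  assert (HM0 : 0 <= M).
  { eapply Rle_trans; [apply Cmod_ge_0 | apply (HM r)].
    rewrite Cmod_R. apply Rabs_pos_eq; lra. }
  assert (Hc : Cmod c = m) by apply Cmod_conj.
  assert (Hc0 : Re (c * H 0)%C = m ^ 2).
  { unfold c, m. rewrite Cmod2_alt. destruct (H 0) as [p q]. simpl. ring. }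
  destruct (HH 0) as [l Hl]. { unfold in_disc. rewrite Cmod_0. lra. }
  destruct (Cderiv_continuous _ _ _ Hl ((m - M) / 2)) as (d & Hd & Hcont); [lra|].
  set (x1 := ln r). set (x0 := Rmin (x1 - 1) (ln (d / 2))).
  assert (Hx1 : x1 < 0). { unfold x1. rewrite <- ln_1. apply ln_increasing; lra. }
  assert (Hx0 : x0 < x1). { eapply Rle_lt_trans; [apply Rmin_l | lra]. }
  assert (Hd0 : exp x0 < d).
  { apply Rle_lt_trans with (d / 2); [|lra].
    rewrite <- (exp_ln (d / 2)) by lra.
    destruct (Rmin_r (x1 - 1) (ln (d / 2))) as [h | h].
    - apply Rlt_le, exp_increasing, h.
    - unfold x0. rewrite h. lra. }
  set (P := fun x y => Re (c * H (Cpolar x y))%C).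
  set (Q := fun x y => Re (Ci * c * H (Cpolar x y))%C).
  assert (HPI := PI_RGT_0).
  assert (DF : divergence_free P Q x0 x1 0 (2 * PI)) by (apply polar_divergence_free; auto).
  assert (F := goursat_flux P Q x0 x1 0 (2 * PI) Hx0 ltac:(lra) DF).
  unfold flux in F.
  replace (RInt (fun x => Q x (2 * PI)) x0 x1) with (RInt (fun x => Q x 0) x0 x1) in F.
  2: { apply RInt_ext. intros x _. unfold Q, Cpolar.
       rewrite cos_2PI, sin_2PI, cos_0, sin_0. reflexivity. }
  assert (U : RInt (fun y => P x1 y) 0 (2 * PI) <= RInt (fun _ => m * M) 0 (2 * PI)).
  { apply RInt_le; [lra| | |].
    - apply (ex_RInt_vertical P Q x0 x1 0 (2 * PI)); auto; lra.
    - apply ex_RInt_const.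
    - intros y _. unfold P. eapply Rle_trans; [apply Rle_abs|].
      eapply Rle_trans; [apply re_le_Cmod|]. rewrite Cmod_mult, Hc.
      apply Rmult_le_compat_l; [apply Cmod_ge_0|]. apply HM.
      rewrite Cmod_Cpolar. apply exp_ln; lra. }
  assert (L : RInt (fun _ => m ^ 2 - m * ((m - M) / 2)) 0 (2 * PI) <=
    RInt (fun y => P x0 y) 0 (2 * PI)).
  { apply RInt_le; [lra| | |].
    - apply ex_RInt_const.
    - apply (ex_RInt_vertical P Q x0 x1 0 (2 * PI)); auto; lra.
    - intros y _. unfold P.
      assert (B : Cmod (c * (H (Cpolar x0 y) - H 0))%C <= m * ((m - M) / 2)).
      { rewrite Cmod_mult, Hc. apply Rmult_le_compat_l; [apply Cmod_ge_0|].
        apply Rlt_le, Hcont. replace (Cpolar x0 y - 0)%C with (Cpolar x0 y) by ring.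
        rewrite Cmod_Cpolar. exact Hd0. }
      assert (B2 := Rle_trans _ _ _ (re_le_Cmod _) B). apply Rabs_le_between in B2.
      replace (c * (H (Cpolar x0 y) - H 0))%C with (c * H (Cpolar x0 y) - c * H 0)%C in B2 by ring.
      unfold Cminus in B2. unfold Re in *.
      change (fst (c * H (Cpolar x0 y) + - (c * H 0))%C)
        with (fst (c * H (Cpolar x0 y))%C + - fst (c * H 0)%C) in B2.
      lra. }
  rewrite !RInt_const in U, L.
  unfold scal in U, L; simpl in U, L; unfold mult in U, L; simpl in U, L.
  assert (m * (m - M) > 0) by (apply Rmult_lt_0_compat; lra).
  assert (m * (m - M) * PI > 0) by (apply Rmult_lt_0_compat; lra).
  nra.
Qed.

(** * The Schwarz-Pick inequality *)

(** Complex differentiability of [f] at the point [z]. *)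
Definition Cdiff (f : C -> C) (z : C) : Prop := exists l, Cderiv f z l.

Lemma Cdiff_const c z : Cdiff (fun _ => c) z.
Proof. eexists. apply is_derive_Cderiv. apply (is_derive_const (K := C_AbsRing)). Qed.

Lemma Cdiff_id z : Cdiff (fun w => w) z.
Proof. eexists. apply is_derive_Cderiv. apply (is_derive_id (K := C_AbsRing)). Qed.

Lemma Cdiff_minus f g z : Cdiff f z -> Cdiff g z -> Cdiff (fun w => f w - g w)%C z.
Proof.
  intros [l Hl] [m Hm]. apply is_derive_Cderiv in Hl, Hm.
  eexists. apply is_derive_Cderiv.
  exact (is_derive_minus (K := C_AbsRing) (V := AbsRing_NormedModule C_AbsRing) f g z l m Hl Hm).
Qed.

Lemma Cdiff_mult f g z : Cdiff f z -> Cdiff g z -> Cdiff (fun w => f w * g w)%C z.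
Proof.
  intros [l Hl] [m Hm]. apply is_derive_Cderiv in Hl, Hm.
  eexists. apply is_derive_Cderiv.
  exact (is_derive_mult (K := C_AbsRing) f g z l m Hl Hm Cmult_comm).
Qed.

Lemma Cdiff_pow f z n : Cdiff f z -> Cdiff (fun w => f w ^ n)%C z.
Proof.
  intros H. induction n; [exact (Cdiff_const 1 z) | exact (Cdiff_mult f _ z H IHn)].
Qed.

Lemma Cdiff_comp f g z : Cdiff g z -> Cdiff f (g z) -> Cdiff (fun w => f (g w)) z.
Proof.
  intros [l Hl] [m Hm]. apply is_derive_Cderiv in Hl, Hm.
  eexists. apply is_derive_Cderiv.
  exact (is_derive_comp (K := C_AbsRing) (V := AbsRing_NormedModule C_AbsRing) f g z m l Hm Hl).
Qed.

Lemma Cdiff_inv (z : C) : z <> 0 -> Cdiff (fun w => / w)%C z.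
Proof.
  intros Hz. exists (- (/ (z * z)))%C. intros eps He.
  assert (Hm : 0 < Cmod z) by (apply Cmod_gt_0; auto).
  assert (H3 : 0 < Cmod z ^ 3) by (apply pow_lt; auto).
  exists (Rmin (Cmod z / 2) (eps * Cmod z ^ 3 / 2)). split.
  { apply Rmin_pos; [lra|]. assert (0 < eps * Cmod z ^ 3) by (apply Rmult_lt_0_compat; auto). lra. }
  intros w Hw.
  assert (Hw1 := Rlt_le_trans _ _ _ Hw (Rmin_l _ _)).
  assert (Hw2 := Rlt_le_trans _ _ _ Hw (Rmin_r _ _)).
  assert (Hwz : Cmod z / 2 <= Cmod w).
  { assert (T := Cmod_triangle (z - w) w). replace (z - w + w)%C with z in T by ring.
    replace (z - w)%C with (- (w - z))%C in T by ring. rewrite Cmod_opp in T. lra. }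
  assert (Hw0 : w <> 0) by (apply Cmod_gt_0; lra).
  replace (/ w - / z - - / (z * z) * (w - z))%C with ((w - z) * (w - z) * / (w * (z * z)))%C
    by (field; auto).
  rewrite !Cmod_mult, Cmod_inv, !Cmod_mult by (repeat apply Cmult_neq_0; auto).
  rewrite Rmult_comm, <- Rmult_assoc. apply Rmult_le_compat_r; [apply Cmod_ge_0|].
  apply Rle_trans with (/ (Cmod z / 2 * (Cmod z * Cmod z)) * (eps * Cmod z ^ 3 / 2)).
  - apply Rmult_le_compat; try apply Cmod_ge_0; [|apply Rinv_le_contravar|lra].
    + apply Rlt_le, Rinv_0_lt_compat. repeat apply Rmult_lt_0_compat; lra.
    + repeat apply Rmult_lt_0_compat; lra.
    + apply Rmult_le_compat_r; [nra | auto].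
  - right. field. lra.
Qed.

Lemma Cdiff_div (f g : C -> C) (z : C) :
  g z <> 0 -> Cdiff f z -> Cdiff g z -> Cdiff (fun w => f w / g w)%C z.
Proof.
  intros H0 Hf Hg. apply Cdiff_mult; auto.
  apply (Cdiff_comp (fun w => / w)%C g); auto. apply Cdiff_inv; auto.
Qed.

Lemma Cmod_sqr_lt1 z : in_disc z -> 0 <= Cmod z ^ 2 < 1.
Proof. unfold in_disc. intros H. generalize (Cmod_ge_0 z). intros. nra. Qed.

Lemma moebius_den_pos a b : in_disc a -> in_disc b -> 0 < Cmod (1 - Cconj a * b)%C.
Proof.
  unfold in_disc. intros Ha Hb.
  assert (T := Cmod_triangle (1 - Cconj a * b) (Cconj a * b)).
  replace (1 - Cconj a * b + Cconj a * b)%C with (RtoC 1) in T by ring.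
  rewrite Cmod_1, Cmod_mult, Cmod_conj in T.
  assert (A := Cmod_ge_0 a). assert (B := Cmod_ge_0 b). nra.
Qed.

Lemma moebius_den_neq0 a b : in_disc a -> in_disc b -> (1 - Cconj a * b)%C <> 0.
Proof. intros. apply Cmod_gt_0, moebius_den_pos; auto. Qed.

(** The identity behind every estimate on the pseudo-hyperbolic distance. *)
Lemma one_minus_moebius a b : in_disc a -> in_disc b ->
  (1 - Cmod (moebius a b) ^ 2) * Cmod (1 - Cconj a * b)%C ^ 2 =
  (1 - Cmod a ^ 2) * (1 - Cmod b ^ 2).
Proof.
  intros Ha Hb. assert (D := moebius_den_pos a b Ha Hb).
  unfold moebius. rewrite Cmod_div by (apply Cmod_gt_0; auto).
  replace ((1 - (Cmod (a - b) / Cmod (1 - Cconj a * b)) ^ 2) * Cmod (1 - Cconj a * b) ^ 2)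
    with (Cmod (1 - Cconj a * b)%C ^ 2 - Cmod (a - b)%C ^ 2) by (field; lra).
  rewrite !Cmod2_alt. destruct a, b; simpl. ring.
Qed.

Lemma moebius_in_disc a b : in_disc a -> in_disc b -> in_disc (moebius a b).
Proof.
  intros Ha Hb. assert (E := one_minus_moebius a b Ha Hb).
  assert (A := Cmod_sqr_lt1 a Ha). assert (B := Cmod_sqr_lt1 b Hb).
  assert (D := moebius_den_pos a b Ha Hb).
  assert (P : 0 < (1 - Cmod a ^ 2) * (1 - Cmod b ^ 2)) by (apply Rmult_lt_0_compat; lra).
  rewrite <- E in P. unfold in_disc.
  assert (0 < Cmod (1 - Cconj a * b)%C ^ 2) by (apply pow_lt; auto).
  assert (0 < 1 - Cmod (moebius a b) ^ 2) by nra.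
  generalize (Cmod_ge_0 (moebius a b)). nra.
Qed.

Lemma moebius_involutive a b : in_disc a -> in_disc b -> moebius a (moebius a b) = b.
Proof.
  intros Ha Hb. assert (D := moebius_den_neq0 a b Ha Hb).
  assert (D2 := moebius_den_neq0 a a Ha Ha).
  assert (E : (1 - Cconj a * moebius a b)%C = ((1 - Cconj a * a) / (1 - Cconj a * b))%C).
  { unfold moebius. field. auto. }
  unfold moebius at 1. rewrite E. unfold moebius. field. auto.
Qed.

Lemma moebius_0_r a : moebius a 0 = a.
Proof. unfold moebius. field. Qed.

Lemma Cdiff_moebius a z : in_disc a -> in_disc z -> Cdiff (moebius a) z.
Proof.
  intros Ha Hz. unfold moebius. apply Cdiff_div.
  - apply moebius_den_neq0; auto.
  - apply Cdiff_minus; [apply Cdiff_const | apply Cdiff_id].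
  - apply Cdiff_minus; [apply Cdiff_const|].
    apply Cdiff_mult; [apply Cdiff_const | apply Cdiff_id].
Qed.

(** The quotient [A / T_b] is bounded near the common zero [b], so the factor [A^2]
    makes the product [O(|z - b|^2)]: its derivative at [b] is 0.  At [b] itself the
    value is 0 whatever the quotient is, because [A b = 0]. *)
Lemma Cdiff_quotient_zero (A : C -> C) b n : in_disc b -> Cdiff A b -> A b = 0 ->
  Cdiff (fun z => A z ^ 2 * (A z / moebius b z) ^ n)%C b.
Proof.
  intros Hb [l Hl] H0. exists 0%C.
  set (k := 1 + Cmod l). assert (Hk : 1 <= k) by (unfold k; generalize (Cmod_ge_0 l); lra).
  destruct (Hl 1 Rlt_0_1) as (d & Hd & B).
  intros eps He. set (L := k ^ 2 * (2 * k) ^ n).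
  assert (HL : 0 < L) by (apply Rmult_lt_0_compat; apply pow_lt; lra).
  exists (Rmin (1 - Cmod b) (Rmin d (eps / L))). split.
  { unfold in_disc in Hb. repeat apply Rmin_pos; try lra. apply Rdiv_lt_0_compat; lra. }
  intros w Hw.
  assert (Hw1 := Rlt_le_trans _ _ _ Hw (Rmin_l _ _)).
  assert (Hw2 := Rlt_le_trans _ _ _ Hw (Rmin_r _ _)).
  assert (Hw3 := Rlt_le_trans _ _ _ Hw2 (Rmin_l _ _)).
  assert (Hw4 := Rlt_le_trans _ _ _ Hw2 (Rmin_r _ _)).
  rewrite H0.
  replace (A w ^ 2 * (A w / moebius b w) ^ n - 0 ^ 2 * (0 / moebius b b) ^ n - 0 * (w - b))%C
    with (A w ^ 2 * (A w / moebius b w) ^ n)%C by (simpl; ring).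
  destruct (Ceq_dec w b) as [-> | Hne].
  { rewrite H0. replace (0 ^ 2 * (0 / moebius b b) ^ n)%C with (RtoC 0) by (simpl; ring).
    rewrite Cmod_0. apply Rmult_le_pos; [lra | apply Cmod_ge_0]. }
  assert (HA : Cmod (A w) <= k * Cmod (w - b)).
  { specialize (B w Hw3). rewrite H0 in B.
    replace (A w) with ((A w - 0 - l * (w - b)) + l * (w - b))%C by ring.
    eapply Rle_trans; [apply Cmod_triangle|]. rewrite (Cmod_mult l). unfold k. lra. }
  assert (Hwd : in_disc w).
  { unfold in_disc. replace w with ((w - b) + b)%C by ring.
    eapply Rle_lt_trans; [apply Cmod_triangle|]. lra. }
  assert (D := moebius_den_neq0 b w Hb Hwd).
  assert (Hpos : 0 < Cmod (w - b)).
  { apply Cmod_gt_0. intros h. apply Hne. replace w with ((w - b) + b)%C by ring. rewrite h. ring. }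
  assert (Hbw : (b - w)%C <> 0).
  { apply Cmod_gt_0. replace (b - w)%C with (- (w - b))%C by ring. rewrite Cmod_opp. auto. }
  assert (HT : Cmod (A w / moebius b w)%C <= 2 * k).
  { unfold moebius.
    replace (A w / ((b - w) / (1 - Cconj b * w)))%C with (A w * (1 - Cconj b * w) / (b - w))%C
      by (field; auto).
    rewrite Cmod_div, Cmod_mult by auto.
    replace (Cmod (b - w)) with (Cmod (w - b)).
    2: { rewrite <- Cmod_opp. f_equal. ring. }
    assert (Cmod (1 - Cconj b * w)%C <= 2).
    { unfold Cminus. eapply Rle_trans; [apply Cmod_triangle|].
      rewrite Cmod_1, Cmod_opp, Cmod_mult, Cmod_conj. unfold in_disc in *.
      generalize (Cmod_ge_0 b) (Cmod_ge_0 w). nra. }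
    apply Rmult_le_reg_r with (Cmod (w - b)); auto.
    unfold Rdiv. rewrite Rmult_assoc, Rinv_l, Rmult_1_r by lra.
    replace (2 * k * Cmod (w - b)) with (k * Cmod (w - b) * 2) by ring.
    apply Rmult_le_compat; auto; apply Cmod_ge_0. }
  rewrite Cmod_mult, !Cmod_pow.
  apply Rle_trans with ((k * Cmod (w - b)) ^ 2 * (2 * k) ^ n).
  { apply Rmult_le_compat; try (apply pow_le, Cmod_ge_0);
    apply pow_incr; split; auto; apply Cmod_ge_0. }
  replace ((k * Cmod (w - b)) ^ 2 * (2 * k) ^ n) with (L * Cmod (w - b) * Cmod (w - b))
    by (unfold L; ring).
  apply Rmult_le_compat_r; [lra|].
  apply Rmult_lt_compat_l with (r := L) in Hw4; auto.
  replace (L * (eps / L)) with eps in Hw4 by (field; lra). lra.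
Qed.

(** The modulus of the Moebius map tends to 1 at the unit circle, uniformly. *)
Lemma moebius_lower_bound_circle b s : in_disc b -> 0 < s < 1 -> exists r, Cmod b < r < 1 /\
  forall z, Cmod z = r -> s <= Cmod (moebius b z).
Proof.
  intros Hb Hs. unfold in_disc in Hb. assert (B := Cmod_ge_0 b).
  set (K := 2 * (1 - Cmod b ^ 2) / (1 - Cmod b) ^ 2).
  assert (HB : 0 < (1 - Cmod b) ^ 2) by (apply pow_lt; lra).
  assert (HK : 0 < K) by (apply Rdiv_lt_0_compat; nra).
  set (e := Rmin ((1 - Cmod b) / 2) ((1 - s ^ 2) / K)).
  assert (He : 0 < e). { apply Rmin_pos; [lra|]. apply Rdiv_lt_0_compat; nra. }
  assert (He1 : e <= (1 - Cmod b) / 2) by apply Rmin_l.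
  assert (He2 : K * e <= 1 - s ^ 2).
  { apply Rle_trans with (K * ((1 - s ^ 2) / K)).
    - apply Rmult_le_compat_l; [lra | apply Rmin_r].
    - right; field; lra. }
  exists (1 - e). split; [lra|]. intros z Hz.
  assert (Hzd : in_disc z) by (unfold in_disc; lra).
  assert (E := one_minus_moebius b z Hb Hzd).
  set (D := Cmod (1 - Cconj b * z)%C) in *. set (T := Cmod (moebius b z)) in *.
  assert (HT : 0 <= T) by apply Cmod_ge_0.
  assert (HT1 : T < 1) by (apply moebius_in_disc; auto).
  assert (HD : 1 - Cmod b <= D).
  { assert (Tr := Cmod_triangle (1 - Cconj b * z) (Cconj b * z)).
    replace (1 - Cconj b * z + Cconj b * z)%C with (RtoC 1) in Tr by ring.
    rewrite Cmod_1, Cmod_mult, Cmod_conj, Hz in Tr. fold D in Tr. nra. }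
  rewrite Hz in E.
  assert (HD2 : (1 - Cmod b) ^ 2 <= D ^ 2) by (apply pow_incr; lra).
  assert (1 - T ^ 2 <= K * e).
  { apply Rmult_le_reg_r with ((1 - Cmod b) ^ 2); auto.
    apply Rle_trans with ((1 - T ^ 2) * D ^ 2).
    - apply Rmult_le_compat_l; nra.
    - rewrite E. unfold K. replace (2 * (1 - Cmod b ^ 2) / (1 - Cmod b) ^ 2 * e * (1 - Cmod b) ^ 2)
        with ((1 - Cmod b ^ 2) * (2 * e)) by (field; lra).
      apply Rmult_le_compat_l; nra. }
  nra.
Qed.

(** Schwarz's lemma for a zero at [b].  If [|A 0| > |b|], then [q = |A 0| / |b|]
    exceeds 1, while [|A 0|^2 q^n <= s^(- n)] for each [s < 1]; this fails for large
    [n] when [q s > 1]. *)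
Lemma schwarz_zero (A : C -> C) b : (forall z, in_disc z -> Cdiff A z) ->
  (forall z, in_disc z -> in_disc (A z)) -> in_disc b -> A b = 0 -> Cmod (A 0) <= Cmod b.
Proof.
  intros HA HD Hb H0.
  destruct (Rle_lt_dec (Cmod (A 0)) (Cmod b)) as [|Hlt]; auto. exfalso.
  assert (Hb0 : 0 < Cmod b).
  { apply Cmod_gt_0. intros ->. rewrite H0, Cmod_0 in Hlt. lra. }
  set (q := Cmod (A 0) / Cmod b).
  assert (Hq : 1 < q).
  { unfold q. apply Rmult_lt_reg_r with (Cmod b); auto.
    unfold Rdiv. rewrite Rmult_assoc, Rinv_l; lra. }
  (* Any [s] with [1 / q < s < 1] would do. *)
  set (s := (1 + / q) / 2).
  assert (Hs : 0 < s < 1).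
  { assert (0 < / q < 1); [|unfold s; lra]. split.
    - apply Rinv_0_lt_compat; lra.
    - rewrite <- Rinv_1. apply Rinv_lt_contravar; lra. }
  destruct (moebius_lower_bound_circle b s Hb Hs) as (r & Hr & Hcirc).
  assert (key : forall n, Cmod (A 0) ^ 2 * q ^ n <= (/ s) ^ n).
  { intros n.
    set (F := fun z => (A z ^ 2 * (A z / moebius b z) ^ n)%C).
    assert (HF0 : Cmod (F 0) = Cmod (A 0) ^ 2 * q ^ n).
    { unfold F. rewrite moebius_0_r, Cmod_mult, !Cmod_pow, Cmod_div; auto.
      apply Cmod_gt_0; auto. }
    rewrite <- HF0. apply Cmod_center_le_circle with r.
    - intros z Hz. change (Cdiff F z). destruct (Ceq_dec z b) as [-> | Hne].
      + apply Cdiff_quotient_zero; auto.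
      + unfold F. assert (moebius b z <> 0).
        { intros h. apply Hne. rewrite <- (moebius_involutive b z), h by auto.
          apply moebius_0_r. }
        apply (Cdiff_mult (fun z => A z ^ 2)%C (fun z => (A z / moebius b z) ^ n)%C).
        * apply Cdiff_pow, HA, Hz.
        * apply (Cdiff_pow (fun z => A z / moebius b z)%C), Cdiff_div; auto.
          apply Cdiff_moebius; auto.
    - lra.
    - intros z Hz. unfold F.
      assert (Hzd : in_disc z) by (unfold in_disc; lra).
      specialize (Hcirc z Hz).
      assert (HAz := HD z Hzd). unfold in_disc in HAz. assert (P := Cmod_ge_0 (A z)).
      rewrite Cmod_mult, !Cmod_pow, Cmod_div by (apply Cmod_gt_0; lra).
      rewrite <- (Rmult_1_l ((/ s) ^ n)).
      assert (Hinv : 0 < / Cmod (moebius b z) <= / s).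
      { split; [apply Rinv_0_lt_compat; lra | apply Rinv_le_contravar; lra]. }
      apply Rmult_le_compat.
      + apply pow_le; auto.
      + apply pow_le. apply Rmult_le_pos; lra.
      + nra.
      + apply pow_incr. split; [apply Rmult_le_pos; lra|].
        unfold Rdiv. rewrite <- (Rmult_1_l (/ s)). apply Rmult_le_compat; lra. }
  assert (Hqs : 1 < q * s).
  { unfold s. replace (q * ((1 + / q) / 2)) with ((q + 1) / 2) by (field; lra). lra. }
  assert (HA0 : 0 < Cmod (A 0) ^ 2) by (apply pow_lt; lra).
  destruct (Pow_x_infinity (q * s)) with (b := 2 / Cmod (A 0) ^ 2) as [N HN].
  { rewrite Rabs_pos_eq; lra. }
  specialize (HN N (Nat.le_refl N)). specialize (key N).
  rewrite Rabs_pos_eq in HN by (apply pow_le; lra).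
  rewrite Rpow_mult_distr in HN. rewrite pow_inv in key.
  assert (Hsn : 0 < s ^ N) by (apply pow_lt; lra).
  apply Rmult_le_compat_r with (r := s ^ N) in key; [|lra].
  rewrite Rinv_l in key by lra.
  apply Rge_le in HN. apply Rmult_le_compat_l with (r := Cmod (A 0) ^ 2) in HN; [|lra].
  replace (Cmod (A 0) ^ 2 * (2 / Cmod (A 0) ^ 2)) with 2 in HN by (field; lra).
  lra.
Qed.

(** Schwarz-Pick in the form [cosh^2 (hyp_dist (f z) (f w)) <= cosh^2 (hyp_dist z w)],
    with denominators cleared. *)
Lemma schwarz_pick (f : C -> C) z w : holomorphic_on_disc f ->
  (forall z, in_disc z -> in_disc (f z)) -> in_disc z -> in_disc w ->
  Cmod (1 - Cconj (f z) * f w)%C ^ 2 * ((1 - Cmod z ^ 2) * (1 - Cmod w ^ 2)) <=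
  Cmod (1 - Cconj z * w)%C ^ 2 * ((1 - Cmod (f z) ^ 2) * (1 - Cmod (f w) ^ 2)).
Proof.
  intros Hf HD Hz Hw.
  assert (S := schwarz_zero (fun x => moebius (f w) (f (moebius z x))) (moebius z w)).
  simpl in S. rewrite moebius_involutive, moebius_0_r in S by auto.
  assert (E1 := one_minus_moebius z w Hz Hw).
  assert (E2 := one_minus_moebius (f w) (f z) (HD w Hw) (HD z Hz)).
  replace (Cmod (1 - Cconj (f w) * f z)%C) with (Cmod (1 - Cconj (f z) * f w)%C) in E2.
  2: { rewrite <- Cmod_conj. f_equal. destruct (f z), (f w).
       unfold Cconj, Cminus, Cplus, Copp, Cmult, RtoC; simpl. f_equal; ring. }
  assert (P1 := moebius_den_pos z w Hz Hw).
  assert (P2 := moebius_den_pos (f z) (f w) (HD z Hz) (HD w Hw)).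
  rewrite <- E1, (Rmult_comm (1 - Cmod (f z) ^ 2)), <- E2.
  assert (L : Cmod (moebius (f w) (f z)) <= Cmod (moebius z w)).
  { apply S.
    - intros x Hx. assert (Hzx := moebius_in_disc z x Hz Hx).
      apply (Cdiff_comp (moebius (f w)) (fun x => f (moebius z x))).
      + apply (Cdiff_comp f (moebius z)).
        * apply Cdiff_moebius; auto.
        * apply ex_derive_Cderiv, Hf, Hzx.
      + apply Cdiff_moebius; auto.
    - intros x Hx. auto using moebius_in_disc.
    - auto using moebius_in_disc.
    - unfold moebius. replace (f w - f w)%C with (RtoC 0) by ring. apply Cmult_0_l. }
  assert (Cmod (moebius (f w) (f z)) ^ 2 <= Cmod (moebius z w) ^ 2).
  { apply pow_incr. split; [apply Cmod_ge_0 | auto]. }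
  set (X := Cmod (1 - Cconj (f z) * f w)%C ^ 2) in *.
  set (Y := Cmod (1 - Cconj z * w)%C ^ 2) in *.
  assert (0 <= X * Y) by (apply Rmult_le_pos; apply pow_le; apply Cmod_ge_0).
  nra.
Qed.

(** * Julia's lemma and radial limits *)

Lemma Cmod_reverse_triangle (u v : C) : Cmod u - Cmod (v - u) <= Cmod v.
Proof.
  assert (T := Cmod_triangle v (- (v - u))). rewrite Cmod_opp in T.
  replace (v + - (v - u))%C with u in T by ring. lra.
Qed.

Lemma Cmod_minus_sym (u v : C) : Cmod (u - v) = Cmod (v - u).
Proof. rewrite <- Cmod_opp. f_equal. ring. Qed.

Lemma Cmod_one_minus_conj (tau z : C) : Cmod tau = 1 ->
  Cmod (1 - Cconj tau * z)%C = Cmod (tau - z).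
Proof.
  intros Ht. replace (Cmod (tau - z)) with (Cmod (Cconj tau * (tau - z))%C).
  - f_equal. replace (RtoC 1) with (Cconj tau * tau)%C; [ring|].
    rewrite Cmult_comm, <- Cmod2_conj, Ht. unfold RtoC, Cpow; simpl. f_equal; ring.
  - rewrite Cmod_mult, Cmod_conj, Ht. ring.
Qed.

Lemma Cmod_one_minus_conj_near (tau u z : C) delta : Cmod tau = 1 -> in_disc z ->
  Cmod (u - tau) < delta ->
  Rabs (Cmod (1 - Cconj u * z)%C - Cmod (tau - z)) <= delta.
Proof.
  intros Ht Hz Hu. rewrite <- (Cmod_one_minus_conj tau z) by auto.
  assert (E : Cmod (Cconj (u - tau) * z)%C <= delta).
  { rewrite Cmod_mult, Cmod_conj. unfold in_disc in Hz.
    generalize (Cmod_ge_0 z) (Cmod_ge_0 (u - tau)). nra. }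
  assert (T1 := Cmod_reverse_triangle (1 - Cconj tau * z) (1 - Cconj u * z)).
  assert (T2 := Cmod_reverse_triangle (1 - Cconj u * z) (1 - Cconj tau * z)).
  replace (1 - Cconj u * z - (1 - Cconj tau * z))%C with (- (Cconj (u - tau) * z))%C in T1.
  2: { destruct u, tau, z. unfold Cconj, Cminus, Cplus, Copp, Cmult, RtoC; simpl. f_equal; ring. }
  replace (1 - Cconj tau * z - (1 - Cconj u * z))%C with (Cconj (u - tau) * z)%C in T2.
  2: { destruct u, tau, z. unfold Cconj, Cminus, Cplus, Copp, Cmult, RtoC; simpl. f_equal; ring. }
  rewrite Cmod_opp in T1. apply Rabs_le; lra.
Qed.

(** [f] multiplies the horocycle level [|tau - z|^2 / (1 - |z|^2)] by at most [q]. *)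
Definition horocycle_contraction (f : C -> C) (tau : C) (q : R) : Prop :=
  forall z, in_disc z ->
  Cmod (tau - f z) ^ 2 * (1 - Cmod z ^ 2) <= q * (Cmod (tau - z) ^ 2 * (1 - Cmod (f z) ^ 2)).

(** Schwarz-Pick for the pair [(a, z)], divided by [1 - |a|^2], in the limit where [a]
    and [f a] tend to [tau]. *)
Lemma julia (f : C -> C) (tau : C) q : holomorphic_on_disc f ->
  (forall z, in_disc z -> in_disc (f z)) -> Cmod tau = 1 -> 0 <= q ->
  (forall delta, 0 < delta -> exists a, in_disc a /\ Cmod (a - tau) < delta /\
     Cmod (f a - tau) < delta /\ 1 - Cmod (f a) ^ 2 <= q * (1 - Cmod a ^ 2)) ->
  horocycle_contraction f tau q.
Proof.
  intros Hf HD Ht Hq Ha z Hz.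
  set (X := Cmod (tau - f z)). set (Y := Cmod (tau - z)).
  set (p := 1 - Cmod z ^ 2). set (p' := 1 - Cmod (f z) ^ 2).
  assert (Hp : 0 < p <= 1) by (unfold p; generalize (Cmod_sqr_lt1 z Hz); lra).
  assert (Hp' : 0 < p' <= 1) by (unfold p'; generalize (Cmod_sqr_lt1 (f z) (HD z Hz)); lra).
  assert (HX : 0 <= X) by apply Cmod_ge_0. assert (HY : 0 <= Y) by apply Cmod_ge_0.
  destruct (Rle_lt_dec (X ^ 2 * p) (q * (Y ^ 2 * p'))) as [|Hlt]; auto. exfalso.
  set (g := X ^ 2 * p - q * (Y ^ 2 * p')).
  set (K := 1 + 2 * X + q * (2 * Y + 1)).
  assert (HK : 1 <= K) by (unfold K; nra).
  assert (HX0 : 0 < X).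
  { destruct HX as [|<-]; auto. exfalso. assert (0 <= q * (Y ^ 2 * p')); [|lra].
    repeat apply Rmult_le_pos; try lra. }
  assert (Hg : 0 < g) by (unfold g; lra).
  set (d := Rmin (Rmin 1 X) (g / K / 2)).
  assert (Hgk : 0 < g / K) by (apply Rdiv_lt_0_compat; lra).
  assert (Hd : 0 < d) by (repeat apply Rmin_pos; lra).
  assert (Hd1 : d <= 1) by (eapply Rle_trans; [apply Rmin_l | apply Rmin_l]).
  assert (Hd2 : d <= X) by (eapply Rle_trans; [apply Rmin_l | apply Rmin_r]).
  assert (Hd3 : d * K < g).
  { apply Rle_lt_trans with (g / K / 2 * K).
    - apply Rmult_le_compat_r; [lra | apply Rmin_r].
    - replace (g / K / 2 * K) with (g / 2) by (field; lra). lra. }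
  destruct (Ha d Hd) as (a & Hda & Ha1 & Ha2 & Ha3).
  assert (SP := schwarz_pick f a z Hf HD Hda Hz).
  assert (Na := Cmod_sqr_lt1 a Hda).
  assert (B1 := Cmod_one_minus_conj_near tau a z d Ht Hz Ha1).
  assert (B2 := Cmod_one_minus_conj_near tau (f a) (f z) d Ht (HD z Hz) Ha2).
  fold X in B2. fold Y in B1. fold p p' in SP.
  set (U := Cmod (1 - Cconj (f a) * f z)%C) in *. set (V := Cmod (1 - Cconj a * z)%C) in *.
  assert (HV : 0 <= V) by apply Cmod_ge_0.
  apply Rabs_le_between in B1. apply Rabs_le_between in B2.
  set (s := 1 - Cmod a ^ 2) in *. set (s' := 1 - Cmod (f a) ^ 2) in *.
  assert (Hs : 0 < s) by (unfold s; lra).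
  assert (SP2 : U ^ 2 * p <= q * (V ^ 2 * p')).
  { apply Rmult_le_reg_r with s; auto.
    apply Rle_trans with (V ^ 2 * (s' * p')).
    - eapply Rle_trans; [|exact SP]. right; ring.
    - replace (q * (V ^ 2 * p') * s) with (V ^ 2 * (q * s * p')) by ring.
      apply Rmult_le_compat_l; [apply pow_le; auto|].
      apply Rmult_le_compat_r; lra. }
  assert (U2 : (X - d) ^ 2 <= U ^ 2) by (apply pow_incr; lra).
  assert (V2 : V ^ 2 <= (Y + d) ^ 2) by (apply pow_incr; lra).
  assert (A1 : (X - d) ^ 2 * p <= U ^ 2 * p) by (apply Rmult_le_compat_r; lra).
  assert (A2 : q * (V ^ 2 * p') <= q * ((Y + d) ^ 2 * p')).
  { apply Rmult_le_compat_l; auto. apply Rmult_le_compat_r; lra. }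
  assert (A3 : X ^ 2 * p - 2 * X * d <= (X - d) ^ 2 * p).
  { assert (0 <= d ^ 2 * p) by (apply Rmult_le_pos; [apply pow_le|]; lra).
    assert (X * d * p <= X * d * 1) by (apply Rmult_le_compat_l; [apply Rmult_le_pos|]; lra).
    nra. }
  assert (A4 : (Y + d) ^ 2 * p' <= Y ^ 2 * p' + d * (2 * Y + 1)).
  { assert (d * (2 * Y + d) * p' <= d * (2 * Y + 1) * 1).
    { apply Rmult_le_compat; try lra. apply Rmult_le_pos; lra.
      apply Rmult_le_compat_l; lra. }
    nra. }
  apply Rmult_le_compat_l with (r := q) in A4; auto.
  unfold K in Hd3. unfold g in *. nra.
Qed.

Lemma Cmod_diameter tau r : Cmod tau = 1 -> 0 <= r -> Cmod (diameter tau r) = r.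
Proof.
  intros Ht Hr. unfold diameter. rewrite Cmod_mult, Cmod_R, Ht, Rabs_pos_eq; lra.
Qed.

Lemma Cmod_minus_diameter tau r : Cmod tau = 1 -> r <= 1 ->
  Cmod (tau - diameter tau r) = 1 - r.
Proof.
  intros Ht Hr. unfold diameter.
  replace (tau - r * tau)%C with (RtoC (1 - r) * tau)%C.
  - rewrite Cmod_mult, Cmod_R, Ht, Rabs_pos_eq; lra.
  - rewrite RtoC_minus. ring.
Qed.

Lemma one_minus_Cmod_sqr_le (tau w : C) : Cmod tau = 1 -> in_disc w ->
  1 - Cmod w ^ 2 <= 2 * Cmod (tau - w).
Proof.
  intros Ht Hw. assert (T := Cmod_reverse_triangle tau w).
  rewrite Cmod_minus_sym, Ht in T. unfold in_disc in Hw. generalize (Cmod_ge_0 w). nra.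
Qed.

(** On the radius, a horocycle contraction bounds the difference quotient at [tau]; as
    [r] tends to 1 the bound on [|tau - f (r tau)| / (1 - r)] tends to [q]. *)
Lemma horocycle_radial f tau q r : horocycle_contraction f tau q ->
  (forall z, in_disc z -> in_disc (f z)) -> Cmod tau = 1 -> 0 <= q -> 0 < r < 1 ->
  Cmod (tau - f (diameter tau r)) * (1 + r) <= 2 * q * (1 - r).
Proof.
  intros Hf HD Ht Hq Hr.
  assert (Hz : in_disc (diameter tau r)).
  { unfold in_disc. rewrite Cmod_diameter by (auto; lra). lra. }
  assert (J := Hf _ Hz).
  rewrite Cmod_minus_diameter, Cmod_diameter in J by (auto; lra).
  assert (B := one_minus_Cmod_sqr_le tau _ Ht (HD _ Hz)).
  set (X := Cmod (tau - f (diameter tau r))) in *.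
  assert (HX : 0 <= X) by apply Cmod_ge_0.
  destruct HX as [HX | <-].
  2: { assert (0 <= 2 * q * (1 - r)) by (apply Rmult_le_pos; lra). lra. }
  apply Rmult_le_reg_l with (X * (1 - r)); [apply Rmult_lt_0_compat; lra|].
  assert (q * ((1 - r) ^ 2 * (1 - Cmod (f (diameter tau r)) ^ 2)) <= q * ((1 - r) ^ 2 * (2 * X))).
  { apply Rmult_le_compat_l; auto. apply Rmult_le_compat_l; [apply pow_le|]; lra. }
  nra.
Qed.

(** Neighbourhoods in [C] may be described by the modulus instead of the product
    distance. *)
Lemma locally_Cmod (P : C -> Prop) (z : C) :
  @locally C_UniformSpace z P <->
  exists delta, 0 < delta /\ forall w, Cmod (w - z) < delta -> P w.
Proof.
  split.
  - intros [d Hd]. exists d. split; [apply cond_pos|]. intros w Hw. apply Hd.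
    apply C_NormedModule_mixin_compat1. exact Hw.
  - intros (d & Hd & H).
    assert (H2 : 0 < d / sqrt 2) by (apply Rdiv_lt_0_compat; [auto | apply Rlt_sqrt2_0]).
    exists (mkposreal _ H2). intros w Hw. apply H.
    apply C_NormedModule_mixin_compat2 in Hw. simpl in Hw.
    replace (sqrt 2 * (d / sqrt 2)) with d in Hw; [exact Hw|].
    field. apply Rgt_not_eq, Rlt_sqrt2_0.
Qed.

Lemma angular_limit_radial g tau l : Cmod tau = 1 -> angular_limit g tau l ->
  forall eps, 0 < eps -> exists delta, 0 < delta <= 1 /\
  forall r, 1 - delta < r < 1 -> Cmod (g (diameter tau r) - l) < eps.
Proof.
  intros Ht Hg eps He.
  assert (L : @locally C_UniformSpace l (fun w => Cmod (w - l) < eps)).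
  { apply locally_Cmod. exists eps. auto. }
  specialize (Hg 2 ltac:(lra) _ L). unfold filtermap, within in Hg.
  apply locally_Cmod in Hg. destruct Hg as (d & Hd & H).
  exists (Rmin d 1). split.
  { split; [apply Rmin_pos; lra | apply Rmin_r]. }
  intros r Hr. assert (M1 := Rmin_l d 1). assert (M2 := Rmin_r d 1).
  apply H.
  - rewrite Cmod_minus_sym, Cmod_minus_diameter by (auto; lra). lra.
  - unfold stolz_region, in_disc.
    rewrite Cmod_minus_diameter, Cmod_diameter by (auto; lra). lra.
Qed.

(** Under [horocycle_contraction f tau 1] the angular limit of [f] at [tau] must be
    [tau]; so the angular derivative is the limit of [|tau - f (r tau)| / (1 - r)]. *)
Lemma angular_derivative_radial f tau alpha : Cmod tau = 1 -> 0 <= alpha ->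
  (forall z, in_disc z -> in_disc (f z)) -> horocycle_contraction f tau 1 ->
  angular_derivative f tau (RtoC alpha) ->
  forall eps, 0 < eps -> exists delta, 0 < delta <= 1 /\ forall r, 1 - delta < r < 1 ->
    (alpha - eps) * (1 - r) <= Cmod (tau - f (diameter tau r)) <= (alpha + eps) * (1 - r).
Proof.
  intros Ht Ha HD HW (p & Hp & Hq).
  (* [p] is the radial limit of [f], and [|tau - f (r tau)| <= 2 (1 - r)]. *)
  assert (Ep : p = tau).
  { destruct (Ceq_dec p tau) as [|Hne]; auto. exfalso.
    assert (Hpos : 0 < Cmod (p - tau)).
    { apply Cmod_gt_0. intros h. apply Hne. replace p with (p - tau + tau)%C by ring.
      rewrite h. ring. }
    set (e := Cmod (p - tau)) in *.
    destruct (angular_limit_radial _ _ _ Ht Hp (e / 2)) as (d & Hd & H); [lra|].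
    set (r := 1 - Rmin (d / 2) (e / 4)).
    assert (M1 := Rmin_l (d / 2) (e / 4)). assert (M2 := Rmin_r (d / 2) (e / 4)).
    assert (M3 : 0 < Rmin (d / 2) (e / 4)) by (apply Rmin_pos; lra).
    assert (Hr : 1 - d < r < 1) by (unfold r; lra).
    specialize (H r Hr).
    assert (B := horocycle_radial f tau 1 r HW HD Ht ltac:(lra) ltac:(lra)).
    set (w := f (diameter tau r)) in *.
    assert (T := Cmod_triangle (p - w) (w - tau)).
    replace (p - w + (w - tau))%C with (p - tau)%C in T by ring. fold e in T.
    rewrite (Cmod_minus_sym p w), (Cmod_minus_sym w tau) in T.
    assert (0 <= Cmod (tau - w)) by apply Cmod_ge_0.
    assert (1 - r <= e / 4) by (unfold r; lra). nra. }
  subst p. intros eps He.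
  destruct (angular_limit_radial _ _ _ Ht Hq eps He) as (d & Hd & H).
  exists d. split; auto. intros r Hr. specialize (H r Hr).
  set (w := f (diameter tau r)) in *.
  assert (Hm : Cmod (diameter tau r - tau) = 1 - r).
  { rewrite Cmod_minus_sym. apply Cmod_minus_diameter; auto; lra. }
  assert (Hn : (diameter tau r - tau)%C <> 0) by (apply Cmod_gt_0; lra).
  assert (T1 := Cmod_reverse_triangle (RtoC alpha) ((w - tau) / (diameter tau r - tau))).
  assert (T2 := Cmod_reverse_triangle ((w - tau) / (diameter tau r - tau)) (RtoC alpha)).
  rewrite (Cmod_minus_sym (RtoC alpha)) in T2.
  rewrite Cmod_div, Hm in T1, T2 by auto.
  rewrite Cmod_R, Rabs_pos_eq in T1, T2 by auto.
  rewrite (Cmod_minus_sym w) in T1, T2.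
  assert (E : Cmod (tau - w) = Cmod (tau - w) / (1 - r) * (1 - r)) by (field; lra).
  rewrite E. split; apply Rmult_le_compat_r; lra.
Qed.

(** Radial points [a = r tau] satisfy the hypothesis of [julia] for each
    [q > alpha]: [1 - |f a|^2] is at most [2 |tau - f a|], which is close to
    [2 alpha (1 - r)], and [1 - r^2] is close to [2 (1 - r)]. *)
Lemma julia_angular f tau alpha : holomorphic_on_disc f ->
  (forall z, in_disc z -> in_disc (f z)) -> Cmod tau = 1 -> 0 <= alpha ->
  horocycle_contraction f tau 1 -> angular_derivative f tau (RtoC alpha) ->
  horocycle_contraction f tau alpha.
Proof.
  intros Hf HD Ht Ha HW Hder z Hz.
  assert (J : forall eps, 0 < eps -> horocycle_contraction f tau (alpha + eps)).
  { intros eps He. apply julia; auto; [lra|]. intros delta Hdl.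
    destruct (angular_derivative_radial f tau alpha Ht Ha HD HW Hder (eps / 2))
      as (d & Hd & H); [lra|].
    set (K := alpha + eps).
    set (e := Rmin (Rmin (d / 2) (delta / 2)) (Rmin (delta / 2 / K) (eps / K))).
    assert (HK : 0 < K) by (unfold K; lra).
    assert (He0 : 0 < e).
    { repeat apply Rmin_pos; try lra; apply Rdiv_lt_0_compat; lra. }
    assert (E1 : e <= d / 2) by (eapply Rle_trans; [apply Rmin_l | apply Rmin_l]).
    assert (E2 : e <= delta / 2) by (eapply Rle_trans; [apply Rmin_l | apply Rmin_r]).
    assert (E3 : K * e <= delta / 2).
    { apply Rle_trans with (K * (delta / 2 / K)); [|right; field; lra].
      apply Rmult_le_compat_l; [lra|]. eapply Rle_trans; [apply Rmin_r | apply Rmin_l]. }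
    assert (E4 : K * e <= eps).
    { apply Rle_trans with (K * (eps / K)); [|right; field; lra].
      apply Rmult_le_compat_l; [lra|]. eapply Rle_trans; [apply Rmin_r | apply Rmin_r]. }
    assert (Hr : 1 - d < 1 - e < 1) by lra.
    specialize (H _ Hr).
    assert (Hzd : in_disc (diameter tau (1 - e))).
    { unfold in_disc. rewrite Cmod_diameter by (auto; lra). lra. }
    exists (diameter tau (1 - e)). split; [auto|]. split; [|split].
    - rewrite Cmod_minus_sym, Cmod_minus_diameter by (auto; lra). lra.
    - rewrite Cmod_minus_sym. unfold K in E3. nra.
    - rewrite Cmod_diameter by (auto; lra).
      assert (B := one_minus_Cmod_sqr_le tau _ Ht (HD _ Hzd)). fold K. unfold K in E4.
      assert ((alpha + eps) * e * e <= eps * e) by (apply Rmult_le_compat_r; lra).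
      unfold K. nra. }
  assert (HA := fun eps He => J eps He z Hz). cbv beta in HA.
  set (X := Cmod (tau - f z) ^ 2 * (1 - Cmod z ^ 2)) in *.
  set (Y := Cmod (tau - z) ^ 2 * (1 - Cmod (f z) ^ 2)) in *.
  apply le_epsilon. intros eps He.
  assert (HY : 0 <= Y).
  { apply Rmult_le_pos; [apply pow_le, Cmod_ge_0|].
    generalize (Cmod_sqr_lt1 (f z) (HD z Hz)); lra. }
  specialize (HA (eps / (1 + Y))).
  assert (0 < eps / (1 + Y)) by (apply Rdiv_lt_0_compat; lra).
  specialize (HA H).
  assert (eps / (1 + Y) * (1 + Y) = eps) by (field; lra). nra.
Qed.

(** * Growth of the orbit and asymptotics of the speeds *)

Lemma in_disc_0 : in_disc 0.
Proof. unfold in_disc. rewrite Cmod_0. lra. Qed.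

Lemma orbit_in_disc phi t : nonelliptic_semigroup phi -> 0 <= t -> in_disc (phi t 0).
Proof. intros H Ht. apply (semigroup_disc phi H); auto. apply in_disc_0. Qed.

Lemma orbit_to_tau phi tau : denjoy_wolff_point phi tau -> forall delta, 0 < delta ->
  exists T, 0 <= T /\ forall t, T <= t -> Cmod (phi t 0 - tau) < delta.
Proof.
  intros [_ H] delta Hd.
  assert (L : @locally C_UniformSpace tau (fun w => Cmod (w - tau) < delta)).
  { apply locally_Cmod. exists delta; auto. }
  destruct (H 0 in_disc_0 _ L) as [T HT].
  exists (Rmax 0 (T + 1)). split; [apply Rmax_l|].
  intros t Ht. apply HT. assert (M := Rmax_r 0 (T + 1)). lra.
Qed.

Lemma orbit_add phi s t : nonelliptic_semigroup phi -> 0 <= s -> 0 <= t ->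
  phi (s + t) 0 = phi t (phi s 0).
Proof.
  intros H Hs Ht. rewrite Rplus_comm. apply (semigroup_add phi H); auto. apply in_disc_0.
Qed.

Lemma nat_multiple_ge t M : 0 < t -> exists k, M <= INR k * t.
Proof.
  intros Ht. destruct (INR_unbounded (M / t)) as [k Hk]. exists k.
  apply Rmult_lt_compat_r with (r := t) in Hk; auto.
  replace (M / t * t) with M in Hk by (field; lra). lra.
Qed.

(** Wolff's lemma.  As [|x s|] tends to 1, it cannot decrease at each step
    from [s] to [s + t], so [julia] applies along the orbit with [q = 1]. *)
Lemma wolff phi tau t : nonelliptic_semigroup phi -> denjoy_wolff_point phi tau -> 0 < t ->
  horocycle_contraction (phi t) tau 1.
Proof.
  intros Hphi Hdw Ht. assert (Htau := proj1 Hdw).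
  apply julia; auto; [| |lra|].
  { apply (semigroup_holo phi Hphi); lra. }
  { intros z Hz. apply (semigroup_disc phi Hphi); auto; lra. }
  intros delta Hd. destruct (orbit_to_tau phi tau Hdw delta Hd) as (T & HT & HTd).
  destruct (classic (exists s, T <= s /\ Cmod (phi s 0) <= Cmod (phi (s + t) 0)))
    as [(s & Hs & Hle) | Hno].
  - exists (phi s 0). rewrite <- orbit_add by (auto; lra).
    split; [apply orbit_in_disc; auto; lra|].
    split; [apply HTd; lra|]. split; [apply HTd; lra|].
    assert (Cmod (phi s 0) ^ 2 <= Cmod (phi (s + t) 0) ^ 2); [|lra].
    apply pow_incr. split; [apply Cmod_ge_0 | auto].
  - exfalso.
    assert (Hdec : forall k, Cmod (phi (T + INR k * t) 0) <= Cmod (phi T 0)).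
    { induction k.
      - simpl. rewrite Rmult_0_l, Rplus_0_r. lra.
      - rewrite S_INR. eapply Rle_trans; [|exact IHk]. apply Rlt_le, Rnot_le_lt.
        intros h. apply Hno. exists (T + INR k * t). split.
        + assert (0 <= INR k * t) by (apply Rmult_le_pos; [apply pos_INR | lra]). lra.
        + replace (T + INR k * t + t) with (T + (INR k + 1) * t) by ring. exact h. }
    assert (H1 : Cmod (phi T 0) < 1) by (apply orbit_in_disc; auto).
    destruct (orbit_to_tau phi tau Hdw (1 - Cmod (phi T 0))) as (T' & HT' & HTd'); [lra|].
    destruct (nat_multiple_ge t T' Ht) as [k Hk].
    specialize (HTd' (T + INR k * t) ltac:(lra)). specialize (Hdec k).
    assert (R := Cmod_reverse_triangle tau (phi (T + INR k * t) 0)). rewrite Htau in R. lra.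
Qed.

Lemma orbit_horocycle phi tau lambda t : nonelliptic_semigroup phi ->
  denjoy_wolff_point phi tau ->
  angular_derivative (phi t) tau (RtoC (exp (- lambda * t))) -> 0 < t ->
  Cmod (tau - phi t 0) ^ 2 <= exp (- lambda * t) * (1 - Cmod (phi t 0) ^ 2).
Proof.
  intros Hphi Hdw Hder Ht.
  assert (J := julia_angular (phi t) tau (exp (- lambda * t))).
  specialize (J (semigroup_holo phi Hphi t ltac:(lra))
    (fun z => semigroup_disc phi Hphi t z ltac:(lra)) (proj1 Hdw)
    (Rlt_le _ _ (exp_pos _)) (wolff phi tau t Hphi Hdw Ht) Hder 0 in_disc_0).
  replace (tau - 0)%C with tau in J by ring. rewrite (proj1 Hdw), Cmod_0 in J. lra.
Qed.

(** Eventually [1 - |x s|^2] is divided by at most [1 / q] in unit time, for every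
    [q] below the angular derivative of [phi 1]. *)
Lemma orbit_step phi tau lambda q : nonelliptic_semigroup phi ->
  denjoy_wolff_point phi tau ->
  angular_derivative (phi 1) tau (RtoC (exp (- lambda))) ->
  0 < q < exp (- lambda) ->
  exists S, 0 <= S /\ forall s, S <= s ->
    q * (1 - Cmod (phi s 0) ^ 2) <= 1 - Cmod (phi (s + 1) 0) ^ 2.
Proof.
  intros Hphi Hdw Hder Hq. assert (Htau := proj1 Hdw).
  destruct (classic (exists S, 0 <= S /\ forall s, S <= s ->
    q * (1 - Cmod (phi s 0) ^ 2) <= 1 - Cmod (phi (s + 1) 0) ^ 2)) as [|Hno]; auto.
  exfalso.
  assert (HD : forall z, in_disc z -> in_disc (phi 1 z)).
  { intros z Hz. apply (semigroup_disc phi Hphi); auto; lra. }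
  assert (J : horocycle_contraction (phi 1) tau q).
  { apply julia; auto; [apply (semigroup_holo phi Hphi); lra | lra |].
    intros delta Hd. destruct (orbit_to_tau phi tau Hdw delta Hd) as (T & HT & HTd).
    apply NNPP. intros Hn. apply Hno. exists T. split; auto. intros s Hs.
    apply Rnot_lt_le. intros Hlt. apply Hn. exists (phi s 0).
    rewrite <- orbit_add by (auto; lra).
    split; [apply orbit_in_disc; auto; lra|].
    split; [apply HTd; lra|]. split; [apply HTd; lra|]. lra. }
  set (alpha := exp (- lambda)) in *.
  destruct (angular_derivative_radial (phi 1) tau alpha Htau ltac:(lra) HD
    (wolff phi tau 1 Hphi Hdw Rlt_0_1) Hder ((alpha - q) / 2)) as (d & Hd & H); [lra|].
  set (e := Rmin (d / 2) ((alpha - q) / (alpha + q))).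
  assert (Hpos : 0 < (alpha - q) / (alpha + q)) by (apply Rdiv_lt_0_compat; lra).
  assert (He : 0 < e) by (apply Rmin_pos; lra).
  assert (E1 : e <= d / 2) by apply Rmin_l.
  assert (E2 : (alpha + q) * e <= alpha - q).
  { apply Rle_trans with ((alpha + q) * ((alpha - q) / (alpha + q))).
    - apply Rmult_le_compat_l; [lra | apply Rmin_r].
    - right; field; lra. }
  specialize (H (1 - e) ltac:(lra)).
  assert (B := horocycle_radial (phi 1) tau q (1 - e) J HD Htau ltac:(lra) ltac:(lra)).
  set (X := Cmod (tau - phi 1 (diameter tau (1 - e)))) in *.
  destruct H as [H _].
  assert (C : (alpha - (alpha - q) / 2) * (1 - (1 - e)) * (1 + (1 - e)) <= X * (1 + (1 - e)))
    by (apply Rmult_le_compat_r; lra).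
  nra.
Qed.

Lemma compact_singleton z0 : compact_set (fun z => z = z0).
Proof.
  intros I U _ Hcov. destruct (Hcov z0 eq_refl) as [i Hi].
  exists (List.cons i List.nil). intros z ->. exists i. split; auto. left; auto.
Qed.

Lemma orbit_continuity phi t : nonelliptic_semigroup phi -> 0 < t ->
  continuity_pt (fun s => 1 - Cmod (phi s 0) ^ 2) t.
Proof.
  intros Hphi Ht.
  assert (Hc : continuity_pt (fun s => Cmod (phi s 0)) t).
  { intros eps He.
    assert (W := semigroup_cont phi Hphi t _ eps (Rlt_le _ _ Ht) (compact_singleton 0)
      (fun z (E : z = RtoC 0) => eq_ind_r in_disc in_disc_0 E) He).
    destruct W as [d Hd].
    exists (Rmin d t). split; [apply Rmin_pos; [apply cond_pos | auto]|].
    intros s [_ Hs]. simpl in Hs. unfold R_dist, Rdist in Hs.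
    assert (M1 := Rmin_l d t). assert (M2 := Rmin_r d t).
    assert (Hs1 : Rabs (s - t) < d) by lra.
    assert (Hs2 : 0 <= s) by (assert (A : Rabs (s - t) < t) by lra; apply Rabs_def2 in A; lra).
    specialize (Hd s Hs1 Hs2 0 eq_refl).
    simpl. unfold R_dist, Rdist.
    assert (T1 := Cmod_reverse_triangle (phi t 0) (phi s 0)).
    assert (T2 := Cmod_reverse_triangle (phi s 0) (phi t 0)).
    rewrite (Cmod_minus_sym (phi t 0)) in T2.
    apply Rabs_def1; lra. }
  apply continuity_pt_minus; [apply continuity_pt_const; intros x y; reflexivity|].
  apply (continuity_pt_mult (fun s => Cmod (phi s 0)) (fun s => Cmod (phi s 0) * 1)); auto.
  apply continuity_pt_mult; auto. apply continuity_pt_const; intros x y; reflexivity.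
Qed.

Lemma one_minus_orbit_pos phi t : nonelliptic_semigroup phi -> 0 <= t ->
  0 < 1 - Cmod (phi t 0) ^ 2 <= 1.
Proof.
  intros Hphi Ht. generalize (Cmod_sqr_lt1 _ (orbit_in_disc phi t Hphi Ht)). lra.
Qed.

(** The quantity [L t = - ln (1 - |x t|^2)], which is twice the total speed up to [O(1)]. *)
Definition gap (phi : R -> C -> C) (t : R) : R := - ln (1 - Cmod (phi t 0) ^ 2).

Lemma gap_upper phi tau lambda eps : nonelliptic_semigroup phi ->
  denjoy_wolff_point phi tau -> 0 <= lambda ->
  angular_derivative (phi 1) tau (RtoC (exp (- lambda))) -> 0 < eps ->
  exists K T, 0 <= T /\ forall t, T <= t -> gap phi t <= K + (lambda + eps) * t.
Proof.
  intros Hphi Hdw Hl Hder He.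
  set (q := exp (- (lambda + eps))).
  assert (Hq : 0 < q < exp (- lambda)).
  { split; [apply exp_pos | apply exp_increasing; lra]. }
  destruct (orbit_step phi tau lambda q Hphi Hdw Hder Hq) as (S0 & HS0 & Hstep0).
  (* [S] is positive, so that two-sided continuity is available on [[S, S + 1]]. *)
  set (S := S0 + 1).
  assert (HS : 0 < S) by (unfold S; lra).
  assert (Hstep : forall s, S <= s ->
    q * (1 - Cmod (phi s 0) ^ 2) <= 1 - Cmod (phi (s + 1) 0) ^ 2).
  { intros s Hs. apply Hstep0. unfold S in Hs. lra. }
  set (y := fun s => 1 - Cmod (phi s 0) ^ 2) in *.
  destruct (continuity_ab_min y S (S + 1)) as (m & Hm & Hm1); [lra| |].
  { intros c Hc. apply orbit_continuity; auto; lra. }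
  set (c := y m) in *.
  assert (Hc : 0 < c) by (apply one_minus_orbit_pos; auto; lra).
  assert (Hk : forall k s, S <= s <= S + 1 -> q ^ k * c <= y (s + INR k)).
  { induction k; intros s Hs.
    - simpl. rewrite Rplus_0_r, Rmult_1_l. auto.
    - rewrite S_INR, <- Rplus_assoc. eapply Rle_trans; [|apply Hstep].
      + simpl. rewrite Rmult_assoc. apply Rmult_le_compat_l; [lra | apply IHk; auto].
      + generalize (pos_INR k); lra. }
  exists (- ln c), S. split; [lra|]. intros t Ht.
  destruct (nfloor_ex (t - S)) as [k Hkt]; [lra|].
  specialize (Hk k (t - INR k) ltac:(lra)).
  replace (t - INR k + INR k) with t in Hk by ring.
  assert (Hqk : 0 < q ^ k) by (apply pow_lt; lra).
  assert (L : ln (q ^ k * c) <= ln (y t)).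
  { apply ln_le; auto. apply Rmult_lt_0_compat; auto. }
  rewrite ln_mult, ln_pow in L by lra. unfold q in L. rewrite ln_exp in L.
  unfold gap. fold (y t).
  assert (INR k * (lambda + eps) <= t * (lambda + eps)) by (apply Rmult_le_compat_r; lra).
  lra.
Qed.

(** [L t] and [b t] are both [lambda t + o(t)]. *)
Lemma orbit_asymptotics phi tau lambda : nonelliptic_semigroup phi ->
  denjoy_wolff_point phi tau -> 0 <= lambda ->
  (forall t, 0 <= t -> angular_derivative (phi t) tau (RtoC (exp (- lambda * t)))) ->
  forall eps, 0 < eps -> exists T, 0 < T /\ forall t, T <= t ->
    0 < Cmod (tau - phi t 0) /\ Rabs (gap phi t - lambda * t) <= eps * t /\
    Rabs (- ln (Cmod (tau - phi t 0)) - lambda * t) <= eps * t.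
Proof.
  intros Hphi Hdw Hl Hder eps He. assert (Htau := proj1 Hdw).
  assert (H1 : angular_derivative (phi 1) tau (RtoC (exp (- lambda)))).
  { replace (- lambda) with (- lambda * 1) by ring. apply Hder; lra. }
  destruct (gap_upper phi tau lambda (eps / 2) Hphi Hdw Hl H1) as (K & T0 & HT0 & HU); [lra|].
  set (K2 := Rabs K + 2 * ln 2).
  assert (Hln2 : 0 < ln 2) by (rewrite <- ln_1; apply ln_increasing; lra).
  assert (HK2 : 0 < K2) by (unfold K2; generalize (Rabs_pos K); lra).
  exists (Rmax (T0 + 1) (K2 * 2 / eps)). split.
  { apply Rlt_le_trans with (T0 + 1); [lra | apply Rmax_l]. }
  intros t Ht.
  assert (Ht0 : T0 + 1 <= t) by (eapply Rle_trans; [apply Rmax_l | exact Ht]).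
  assert (HtK : K2 <= eps / 2 * t).
  { assert (A : K2 * 2 / eps <= t) by (eapply Rle_trans; [apply Rmax_r | exact Ht]).
    apply Rmult_le_compat_l with (r := eps / 2) in A; [|lra].
    replace (eps / 2 * (K2 * 2 / eps)) with K2 in A by (field; lra). exact A. }
  specialize (HU t ltac:(lra)).
  assert (Y := one_minus_orbit_pos phi t Hphi ltac:(lra)).
  assert (Hd := orbit_in_disc phi t Hphi ltac:(lra)).
  assert (B1 := one_minus_Cmod_sqr_le tau _ Htau Hd).
  assert (B2 := orbit_horocycle phi tau lambda t Hphi Hdw (Hder t ltac:(lra)) ltac:(lra)).
  unfold gap in *.
  set (y := 1 - Cmod (phi t 0) ^ 2) in *. set (X := Cmod (tau - phi t 0)) in *.
  assert (HX : 0 < X) by lra. split; auto.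
  assert (L1 : ln y <= ln 2 + ln X).
  { rewrite <- ln_mult by lra. apply ln_le; lra. }
  assert (L2 : 2 * ln X <= - lambda * t + ln y).
  { assert (E : ln (X ^ 2) = 2 * ln X) by (rewrite ln_pow by auto; simpl; ring).
    rewrite <- E. rewrite <- (ln_exp (- lambda * t)), <- ln_mult by (try apply exp_pos; lra).
    apply ln_le; [apply pow_lt; auto|exact B2]. }
  assert (HK := Rle_abs K). unfold K2 in HtK.
  assert (0 <= Rabs K) by apply Rabs_pos.
  split; apply Rabs_le; split; lra.
Qed.

(** The square of the hyperbolic cosine of [hyp_dist z w], for [z] and [w] in the disc. *)
Definition cosh2 (z w : C) : R :=
  Cmod (1 - Cconj z * w)%C ^ 2 / ((1 - Cmod z ^ 2) * (1 - Cmod w ^ 2)).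

Lemma cosh2_moebius z w : in_disc z -> in_disc w ->
  0 < cosh2 z w /\ cosh2 z w * (1 - Cmod (moebius z w) ^ 2) = 1.
Proof.
  intros Hz Hw. assert (E := one_minus_moebius z w Hz Hw).
  assert (D := moebius_den_pos z w Hz Hw).
  assert (A := Cmod_sqr_lt1 z Hz). assert (B := Cmod_sqr_lt1 w Hw).
  assert (P : 0 < (1 - Cmod z ^ 2) * (1 - Cmod w ^ 2)) by (apply Rmult_lt_0_compat; lra).
  split.
  - unfold cosh2. apply Rdiv_lt_0_compat; auto. apply pow_lt; auto.
  - unfold cosh2. rewrite <- E. field. split; [lra|].
    intros h. rewrite h in E. lra.
Qed.

Lemma hyp_dist_bounds z w : in_disc z -> in_disc w ->
  / 2 * ln (cosh2 z w) <= hyp_dist z w <= / 2 * ln (4 * cosh2 z w).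
Proof.
  intros Hz Hw. destruct (cosh2_moebius z w Hz Hw) as [HQ E].
  assert (HT := moebius_in_disc z w Hz Hw). unfold in_disc in HT.
  assert (HT0 := Cmod_ge_0 (moebius z w)).
  unfold hyp_dist. set (T := Cmod (moebius z w)) in *. set (Q := cosh2 z w) in *.
  assert (EQ : (1 + T) / (1 - T) = (1 + T) ^ 2 * Q).
  { apply Rmult_eq_reg_r with (1 - T); [|lra].
    replace ((1 + T) ^ 2 * Q * (1 - T)) with ((1 + T) * (Q * (1 - T ^ 2))) by ring.
    rewrite E. field. lra. }
  rewrite EQ.
  assert (1 * Q <= (1 + T) ^ 2 * Q) by (apply Rmult_le_compat_r; nra).
  assert ((1 + T) ^ 2 * Q <= 4 * Q) by (apply Rmult_le_compat_r; nra).
  split; apply Rmult_le_compat_l; try lra; apply ln_le; lra.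
Qed.

Lemma hyp_dist_lt z w z' w' : in_disc z -> in_disc w -> in_disc z' -> in_disc w' ->
  cosh2 z w < cosh2 z' w' -> hyp_dist z w < hyp_dist z' w'.
Proof.
  intros Hz Hw Hz' Hw' Hlt.
  destruct (cosh2_moebius z w Hz Hw) as [HQ E].
  destruct (cosh2_moebius z' w' Hz' Hw') as [HQ' E'].
  assert (HT := moebius_in_disc z w Hz Hw). assert (HT' := moebius_in_disc z' w' Hz' Hw').
  unfold in_disc in HT, HT'.
  assert (HT0 := Cmod_ge_0 (moebius z w)). assert (HT0' := Cmod_ge_0 (moebius z' w')).
  unfold hyp_dist.
  set (T := Cmod (moebius z w)) in *. set (T' := Cmod (moebius z' w')) in *.
  assert (H : T < T').
  { apply Rnot_le_lt. intros h. assert (T' ^ 2 <= T ^ 2) by (apply pow_incr; lra).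
    assert (0 < 1 - T ^ 2) by nra. nra. }
  apply Rmult_lt_compat_l; [lra|]. apply ln_increasing.
  - apply Rdiv_lt_0_compat; lra.
  - unfold Rdiv. apply Rmult_gt_0_lt_compat; try lra.
    + apply Rinv_0_lt_compat; lra.
    + apply Rinv_0_lt_contravar; lra.
Qed.

Lemma hyp_dist_le z w z' w' : in_disc z -> in_disc w -> in_disc z' -> in_disc w' ->
  cosh2 z w <= cosh2 z' w' -> hyp_dist z w <= hyp_dist z' w'.
Proof.
  intros Hz Hw Hz' Hw' [Hlt | Heq].
  - apply Rlt_le, hyp_dist_lt; auto.
  - destruct (cosh2_moebius z w Hz Hw) as [HQ E].
    destruct (cosh2_moebius z' w' Hz' Hw') as [HQ' E'].
    rewrite <- Heq in E'. rewrite <- E in E'. apply Rmult_eq_reg_l in E'; [|lra].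
    assert (T : Cmod (moebius z w) = Cmod (moebius z' w')).
    { assert (A := Cmod_ge_0 (moebius z w)). assert (B := Cmod_ge_0 (moebius z' w')). nra. }
    unfold hyp_dist. rewrite T. lra.
Qed.

(** Signed position on the diameter of the orthogonal projection of [z].  In the
    half-plane coordinate [(tau + z) / (tau - z)] the diameter is the positive
    half-line and the projection of a point is its modulus. *)
Definition foot (tau z : C) : R :=
  (Cmod (tau + z) - Cmod (tau - z)) / (Cmod (tau + z) + Cmod (tau - z)).

Lemma Cmod_plus_minus_pos tau z : Cmod tau = 1 -> in_disc z ->
  0 < Cmod (tau + z) /\ 0 < Cmod (tau - z).
Proof.
  unfold in_disc. intros Ht Hz.
  assert (T1 := Cmod_reverse_triangle tau (- z)%C). assert (T2 := Cmod_reverse_triangle tau z).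
  replace (- z - tau)%C with (- (tau + z))%C in T1 by ring.
  rewrite !Cmod_opp in T1. rewrite Cmod_minus_sym in T2. lra.
Qed.

Lemma foot_bounds tau z : Cmod tau = 1 -> in_disc z -> -1 < foot tau z < 1.
Proof.
  intros Ht Hz. destruct (Cmod_plus_minus_pos tau z Ht Hz) as [P1 P2]. unfold foot. split.
  - apply Rmult_lt_reg_r with (Cmod (tau + z) + Cmod (tau - z)); [lra|].
    unfold Rdiv. rewrite Rmult_assoc, Rinv_l; lra.
  - apply Rmult_lt_reg_r with (Cmod (tau + z) + Cmod (tau - z)); [lra|].
    unfold Rdiv. rewrite Rmult_assoc, Rinv_l; lra.
Qed.

Lemma Cmod_diameter_sqr tau r : Cmod tau = 1 -> Cmod (diameter tau r) ^ 2 = r ^ 2.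
Proof.
  intros Ht. unfold diameter. rewrite Cmod_mult, Cmod_R, Ht, Rmult_1_r, pow2_abs. reflexivity.
Qed.

Lemma diameter_in_disc tau r : Cmod tau = 1 -> -1 < r < 1 -> in_disc (diameter tau r).
Proof.
  intros Ht Hr. unfold in_disc, diameter. rewrite Cmod_mult, Cmod_R, Ht, Rmult_1_r.
  apply Rabs_def1; lra.
Qed.

(** Completing the square: the last term is nonnegative, and vanishes exactly at
    [r = foot tau z]. *)
Lemma cosh2_diameter tau z r : Cmod tau = 1 -> in_disc z -> -1 < r < 1 ->
  cosh2 z (diameter tau r) =
  / 2 + Cmod (tau + z) * Cmod (tau - z) / (2 * (1 - Cmod z ^ 2)) +
  ((1 - r) * Cmod (tau + z) - (1 + r) * Cmod (tau - z)) ^ 2 /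
    (4 * (1 - r ^ 2) * (1 - Cmod z ^ 2)).
Proof.
  intros Ht Hz Hr. unfold cosh2. rewrite Cmod_diameter_sqr by auto.
  assert (Nz := Cmod_sqr_lt1 z Hz).
  assert (Hr2 : 0 < 1 - r ^ 2) by nra.
  assert (Ht2 : Cmod tau ^ 2 = 1) by (rewrite Ht; ring).
  assert (E : Cmod (1 - Cconj z * diameter tau r)%C ^ 2 =
    (1 - r ^ 2) * (1 - Cmod z ^ 2) / 2 +
    ((1 - r) ^ 2 * Cmod (tau + z) ^ 2 + (1 + r) ^ 2 * Cmod (tau - z) ^ 2) / 4).
  { revert Ht2. unfold diameter. rewrite !Cmod2_alt. destruct tau as [p q], z as [x y].
    simpl. intros Ht2.
    assert (Ep : p * p = 1 - q * q) by lra. field [Ep]. }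
  rewrite E. field. split; nra.
Qed.

Lemma proj_diameter_foot tau z : Cmod tau = 1 -> in_disc z ->
  proj_diameter tau z = diameter tau (foot tau z).
Proof.
  intros Ht Hz. assert (Hf := foot_bounds tau z Ht Hz).
  destruct (Cmod_plus_minus_pos tau z Ht Hz) as [P1 P2].
  assert (Nz := Cmod_sqr_lt1 z Hz).
  assert (Efoot : cosh2 z (diameter tau (foot tau z)) =
    / 2 + Cmod (tau + z) * Cmod (tau - z) / (2 * (1 - Cmod z ^ 2))).
  { rewrite cosh2_diameter by auto.
    replace ((1 - foot tau z) * Cmod (tau + z) - (1 + foot tau z) * Cmod (tau - z)) with 0.
    - unfold Rdiv. rewrite pow_i by lia. ring.
    - unfold foot. field. lra. }
  assert (Hmin : closest_on_diameter tau z (diameter tau (foot tau z))).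
  { split; [exists (foot tau z); auto|]. intros w (r & Hr & ->).
    apply hyp_dist_le; auto using diameter_in_disc.
    rewrite Efoot, cosh2_diameter by auto.
    assert (0 <= ((1 - r) * Cmod (tau + z) - (1 + r) * Cmod (tau - z)) ^ 2 /
      (4 * (1 - r ^ 2) * (1 - Cmod z ^ 2))); [|lra].
    apply Rmult_le_pos; [apply pow2_ge_0|]. apply Rlt_le, Rinv_0_lt_compat.
    repeat apply Rmult_lt_0_compat; nra. }
  assert (Hs := epsilon_spec (inhabits (RtoC 0)) (closest_on_diameter tau z)
    (ex_intro _ _ Hmin)).
  fold (proj_diameter tau z) in Hs. destruct Hs as [(r & Hr & Er) Hcl].
  rewrite Er in *. f_equal.
  assert (HQ : cosh2 z (diameter tau r) <= cosh2 z (diameter tau (foot tau z))).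
  { apply Rnot_lt_le. intros h.
    apply (hyp_dist_lt z (diameter tau (foot tau z)) z (diameter tau r)) in h;
      auto using diameter_in_disc.
    specialize (Hcl _ (proj1 Hmin)). lra. }
  rewrite Efoot, cosh2_diameter in HQ by auto.
  set (u := (1 - r) * Cmod (tau + z) - (1 + r) * Cmod (tau - z)) in *.
  assert (Hden : 0 < 4 * (1 - r ^ 2) * (1 - Cmod z ^ 2)) by (repeat apply Rmult_lt_0_compat; nra).
  assert (Hu : u ^ 2 <= 0).
  { assert (A : u ^ 2 / (4 * (1 - r ^ 2) * (1 - Cmod z ^ 2)) <= 0) by lra.
    apply Rmult_le_compat_r with (r := 4 * (1 - r ^ 2) * (1 - Cmod z ^ 2)) in A; [|lra].
    unfold Rdiv in A. rewrite Rmult_assoc, Rinv_l in A; lra. }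
  assert (Hu0 : u = 0) by nra.
  unfold foot. apply Rmult_eq_reg_r with (Cmod (tau + z) + Cmod (tau - z)); [|lra].
  unfold Rdiv. rewrite Rmult_assoc, Rinv_l by lra. unfold u in Hu0. lra.
Qed.

Lemma cosh2_zero z : in_disc z -> cosh2 0 z = / (1 - Cmod z ^ 2).
Proof.
  intros Hz. unfold cosh2. replace (1 - Cconj 0 * z)%C with (RtoC 1).
  - rewrite Cmod_1, Cmod_0. generalize (Cmod_sqr_lt1 z Hz). intros. field. lra.
  - replace (Cconj 0) with (RtoC 0); [ring|]. unfold Cconj, RtoC; simpl. f_equal; ring.
Qed.

Lemma speeds_logarithms tau z : Cmod tau = 1 -> in_disc z -> Cmod (tau - z) <= 1 ->
  let L := - ln (1 - Cmod z ^ 2) in let b := - ln (Cmod (tau - z)) in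
  Rabs (hyp_dist 0 z - L / 2) <= 2 * ln 2 /\
  Rabs (hyp_dist 0 (proj_diameter tau z) - b / 2) <= 2 * ln 2 /\
  Rabs (hyp_dist z (proj_diameter tau z) - (L - b) / 2) <= 2 * ln 2.
Proof.
  intros Ht Hz Hle L b.
  destruct (Cmod_plus_minus_pos tau z Ht Hz) as [P1 P2].
  assert (Hf := foot_bounds tau z Ht Hz).
  assert (Nz := Cmod_sqr_lt1 z Hz).
  assert (Hp := diameter_in_disc tau _ Ht Hf).
  rewrite proj_diameter_foot by auto.
  assert (D1 := hyp_dist_bounds 0 z in_disc_0 Hz).
  assert (D2 := hyp_dist_bounds 0 _ in_disc_0 Hp).
  assert (D3 := hyp_dist_bounds z _ Hz Hp).
  rewrite cosh2_zero in D1, D2 by auto. rewrite Cmod_diameter_sqr in D2 by auto.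
  rewrite cosh2_diameter in D3 by auto.
  replace ((1 - foot tau z) * Cmod (tau + z) - (1 + foot tau z) * Cmod (tau - z)) with 0 in D3
    by (unfold foot; field; lra).
  assert (HX1 : 1 <= Cmod (tau + z) <= 2).
  { split.
    - assert (T := Cmod_triangle (tau + z) (tau - z)).
      replace (tau + z + (tau - z))%C with (RtoC 2 * tau)%C in T.
      2: { replace (RtoC 2) with (1 + 1)%C; [ring|]. rewrite <- RtoC_plus. f_equal. }
      rewrite Cmod_mult, Cmod_R, Ht, Rabs_pos_eq in T; lra.
    - assert (T := Cmod_triangle tau z). unfold in_disc in Hz. lra. }
  assert (HB := one_minus_Cmod_sqr_le tau z Ht Hz).
  assert (Hfe : 1 - foot tau z ^ 2 =
    4 * (Cmod (tau + z) * Cmod (tau - z)) / (Cmod (tau + z) + Cmod (tau - z)) ^ 2).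
  { unfold foot. field. lra. }
  rewrite Hfe in D2.
  set (X := Cmod (tau + z)) in *. set (Y := Cmod (tau - z)) in *.
  set (y := 1 - Cmod z ^ 2) in *.
  replace (0 ^ 2 / (4 * (1 - foot tau z ^ 2) * y)) with 0 in D3.
  2: { unfold Rdiv. rewrite pow_i by lia. ring. }
  assert (Hy : 0 < y) by (unfold y; lra).
  assert (HXY : 0 < X * Y) by (apply Rmult_lt_0_compat; lra).
  assert (ln4 : ln 4 = 2 * ln 2).
  { replace 4 with (2 * 2) by ring. rewrite ln_mult by lra. ring. }
  assert (ln2 : 0 < ln 2) by (rewrite <- ln_1; apply ln_increasing; lra).
  split; [|split].
  - rewrite ln_mult, ln_Rinv, ln4 in D1 by (auto; try apply Rinv_0_lt_compat; lra).
    unfold L. apply Rabs_le; lra.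
  - assert (Hinv : / (4 * (X * Y) / (X + Y) ^ 2) = (X + Y) ^ 2 / (4 * X) * / Y).
    { field. repeat split; lra. }
    rewrite Hinv in D2.
    set (W := (X + Y) ^ 2 / (4 * X)) in *.
    assert (HW : / 4 <= W <= 4).
    { unfold W. split; apply Rmult_le_reg_r with (4 * X); try lra;
      unfold Rdiv; rewrite ?Rmult_assoc, Rinv_l by lra; nra. }
    assert (LW1 : - (2 * ln 2) <= ln W).
    { rewrite <- ln4, <- ln_Rinv by lra. apply ln_le; lra. }
    assert (LW2 : ln W <= 2 * ln 2) by (rewrite <- ln4; apply ln_le; lra).
    assert (0 < / Y) by (apply Rinv_0_lt_compat; lra).
    rewrite (ln_mult 4), ln_mult, ln_Rinv, ln4 in D2
      by (auto; try lra; apply Rmult_lt_0_compat; lra).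
    unfold b. apply Rabs_le; lra.
  - set (V := / 2 + X * Y / (2 * y) + 0) in *.
    assert (HYy : 0 < Y / y) by (apply Rdiv_lt_0_compat; lra).
    assert (HVe : V * y = y / 2 + X * Y / 2) by (unfold V; field; lra).
    assert (EY : Y / y * y = Y) by (field; lra).
    assert (HV1 : / 2 * (Y / y) <= V).
    { apply Rmult_le_reg_r with y; auto. rewrite HVe, Rmult_assoc, EY. nra. }
    assert (HV2 : V <= 2 * (Y / y)).
    { apply Rmult_le_reg_r with y; auto. rewrite HVe, Rmult_assoc, EY. nra. }
    assert (ELb : ln (Y / y) = L - b).
    { unfold L, b. rewrite ln_div by lra. ring. }
    assert (LV1 : - ln 2 + (L - b) <= ln V).
    { rewrite <- ELb, <- ln_Rinv, <- ln_mult by (auto; lra). apply ln_le; lra. }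
    assert (LV2 : ln V <= ln 2 + (L - b)).
    { rewrite <- ELb, <- ln_mult by (auto; lra). apply ln_le; lra. }
    rewrite ln_mult, ln4 in D3 by lra. apply Rabs_le; lra.
Qed.

Lemma is_lim_div_t (g : R -> R) l :
  (forall eps, 0 < eps -> exists T, forall t, T <= t -> Rabs (g t - l * t) <= eps * t) ->
  is_lim (fun t => g t / t) p_infty (Finite l).
Proof.
  intros H. apply is_lim_spec. intros eps.
  destruct (H (eps / 2)) as [T HT]. { generalize (cond_pos eps); lra. }
  exists (Rmax T 1). intros t Ht.
  assert (M1 := Rmax_l T 1). assert (M2 := Rmax_r T 1).
  specialize (HT t ltac:(lra)).
  replace (g t / t - l) with ((g t - l * t) * / t) by (field; lra).
  rewrite Rabs_mult, (Rabs_pos_eq (/ t)) by (apply Rlt_le, Rinv_0_lt_compat; lra).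
  apply Rle_lt_trans with (eps / 2 * t * / t).
  - apply Rmult_le_compat_r; auto. apply Rlt_le, Rinv_0_lt_compat; lra.
  - rewrite Rmult_assoc, Rinv_r by lra. generalize (cond_pos eps); lra.
Qed.

Theorem proposition6p1 (phi : R -> C -> C) (tau : C) (lambda : R)
    (Hphi : nonelliptic_semigroup phi)
    (Htau : denjoy_wolff_point phi tau)
    (Hlambda : 0 <= lambda)
    (Hder : forall t : R, 0 <= t ->
      angular_derivative (phi t) tau (RtoC (exp (- lambda * t)))) :
  is_lim (fun t => total_speed phi t / t) p_infty (Finite (lambda / 2)) /\
  is_lim (fun t => orthogonal_speed phi tau t / t) p_infty (Finite (lambda / 2)) /\
  is_lim (fun t => tangential_speed phi tau t / t) p_infty (Finite 0).
Proof.
  assert (ln2 : 0 < ln 2) by (rewrite <- ln_1; apply ln_increasing; lra).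
  assert (K : forall eps, 0 < eps -> exists T, forall t, T <= t ->
    Rabs (total_speed phi t - lambda / 2 * t) <= eps * t /\
    Rabs (orthogonal_speed phi tau t - lambda / 2 * t) <= eps * t /\
    Rabs (tangential_speed phi tau t - 0 * t) <= eps * t).
  { intros eps He.
    destruct (orbit_asymptotics phi tau lambda Hphi Htau Hlambda Hder (eps / 2))
      as (T1 & HT1 & H1); [lra|].
    destruct (orbit_to_tau phi tau Htau 1 Rlt_0_1) as (T2 & HT2 & H2).
    set (T3 := 4 * ln 2 / eps).
    exists (Rmax T1 (Rmax T2 T3)). intros t Ht.
    assert (M1 := Rmax_l T1 (Rmax T2 T3)). assert (M2 := Rmax_r T1 (Rmax T2 T3)).
    assert (M3 := Rmax_l T2 T3). assert (M4 := Rmax_r T2 T3).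
    destruct (H1 t ltac:(lra)) as (HX & HL & Hb).
    assert (HY := H2 t ltac:(lra)). rewrite Cmod_minus_sym in HY.
    assert (HE : 2 * ln 2 <= eps / 2 * t).
    { assert (A : T3 <= t) by lra. apply Rmult_le_compat_l with (r := eps / 2) in A; [|lra].
      replace (eps / 2 * T3) with (2 * ln 2) in A by (unfold T3; field; lra). exact A. }
    destruct (speeds_logarithms tau (phi t 0) (proj1 Htau)
      (orbit_in_disc phi t Hphi ltac:(lra)) ltac:(lra)) as (S1 & S2 & S3).
    unfold total_speed, orthogonal_speed, tangential_speed, gap in *.
    apply Rabs_le_between in HL, Hb, S1, S2, S3.
    repeat split; apply Rabs_le; lra. }
  split; [|split]; apply is_lim_div_t; intros eps He;
    destruct (K eps He) as [T HT]; exists T; intros t Ht; apply HT; auto.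
Qed.
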